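(* Let $N\ge2$ be an integer, let $\pi$ be a prior on $\Delta_{N-1}$ with full support, and let $\theta_0$ be a fixed point in the interior of $\Delta_{N-1}$. If $\pi$ has a density $q$ (with respect to the Lebesgue measure) such that $q\in C^1(\overline{\Delta_{N-1}})$ and $q(\theta)=0$ for any $\theta\in\partial\Delta_{N-1}$, then, for the multinomial model, as $n\to+\infty$, $$\epsilon_n=O\big(n^{-1/2}\big).$$
   Context: $\Delta_{N-1}=\{\theta=(\theta_1,\dots,\theta_{N-1})\in[0,1]^{N-1}:\sum_{i=1}^{N-1}\theta_i\le1\}$, and $\theta_N:=1-\sum_{i=1}^{N-1}\theta_i$. Multinomial model: observations take values in a finite set $\{a_1,\dots,a_N\}$ and under $\theta$ the value $a_i$ has probability $\theta_i$. The posterior is $$\pi_n(\mathrm d\theta\,|\,x_1,\dots,x_n)=\frac{\big[\prod_{i=1}^N\theta_i^{\nu_{n,i}(x)}\big]\pi(\mathrm d\theta)}{\int_{\Delta_{N-1}}\big[\prod_{i=1}^Nt_i^{\nu_{n,i}(x)}\big]\pi(\mathrm dt)},\qquad\nu_{n,i}(x)=\sum_{j=1}^n\mathbf 1\{x_j=a_i\}.$$ $\xi_1,\xi_2,\dots$ are i.i.d. with $\mathbb P[\xi_1=a_i]=\theta_{0,i}$, $i=1,\dots,N$. The posterior contraction rate (PCR) at $\theta_0$ considered is $$\epsilon_n=\mathbb E\big[\mathcal W_2(\pi_n(\cdot\,|\,\xi_1,\dots,\xi_n);\delta_{\theta_0})\big]=\mathbb E\Big[\Big(\int_{\Delta_{N-1}}|\theta-\theta_0|^2\,\pi_n(\mathrm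 d\theta\,|\,\xi_1,\dots,\xi_n)\Big)^{1/2}\Big],$$ where $\mathcal W_2$ is the 2-Wasserstein distance for the Euclidean distance.
   Formalization: The formal theorem additionally assumes q(θ_0)>0; with full support read only topologically the claim fails, e.g. N=2, θ_0=1/2, q(t)=c t(1−t)exp(−1/|t−1/2|), where ε_n is of order n^{-1/3}. *)

(* Defs.v *)
From HB Require Import structures.
From mathcomp Require Import all_boot all_order all_algebra.
From mathcomp Require Import all_classical all_reals all_analysis.

Set Implicit Arguments.
Unset Strict Implicit.
Unset Printing Implicit Defensive.

Import Order.TTheory GRing.Theory Num.Theory.
Import numFieldNormedType.Exports.

Local Open Scope classical_set_scope.
Local Open Scope ring_scope.

(* The sigma-algebra generated by the coordinates; over a real type it is the
   Borel sigma-algebra of R^n. *)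
Definition measure_rV_display : measure_display -> measure_display.
Proof. exact. Qed.

Section measurable_rV.
Context {d : measure_display} {T : measurableType d} (n : nat).

Let coors : 'I_n -> 'rV[T]_n -> T := fun i x => x ord0 i.

Let rV_set0 : g_sigma_preimage coors set0.
Proof. exact: sigma_algebra0. Qed.

Let rV_setC A : g_sigma_preimage coors A -> g_sigma_preimage coors (~` A).
Proof. exact: sigma_algebraC. Qed.

Let rV_bigcup (F : _^nat) : (forall i, g_sigma_preimage coors (F i)) ->
  g_sigma_preimage coors (\bigcup_i (F i)).
Proof. exact: sigma_algebra_bigcup. Qed.

HB.instance Definition _ := @isMeasurable.Build (measure_rV_display d)
  'rV[T]_n (g_sigma_preimage coors) rV_set0 rV_setC rV_bigcup.

Lemma measurable_rV_coord (i : 'I_n) :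
  measurable_fun [set: 'rV[T]_n] (fun x : 'rV[T]_n => x ord0 i).
Proof.
move=> _ Y mY; rewrite setTI; apply: sub_sigma_algebra => /=.
rewrite -bigcup_seq/=; exists i => /=; first by rewrite mem_index_enum.
by exists Y => //; rewrite setTI.
Qed.

Lemma measurable_fun_rV d' (S : measurableType d') (f : S -> 'rV[T]_n) :
  (forall i, measurable_fun setT (fun x => f x ord0 i)) ->
  measurable_fun setT f.
Proof.
move=> mf.
have sub : g_sigma_preimage (fun i x => f x ord0 i) `<=` measurable.
  apply: smallest_sub; first exact: sigma_algebra_measurable.
  elim/big_ind : _ => [|A B mA mB|i _]; first exact: sub0set.
    by rewrite subUset; split.
  by move=> _ [B mB <-]; exact: mf.
move=> _ A mA; apply: sub.
rewrite (_ : (fun i x => _) = fun i => coors i \o f)// g_sigma_preimage_comp.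
by exists A.
Qed.

End measurable_rV.

Section lebesgue_rV.
Context {R : realType}.
Local Open Scope ereal_scope.

Definition rV_cons n (p : R * 'rV[R]_n) : 'rV[R]_n.+1 :=
  row_mx (const_mx p.1 : 'rV[R]_1) p.2.

Lemma rV_consE0 n (p : R * 'rV[R]_n) (j : 'I_1) :
  rV_cons p ord0 (lshift n j) = p.1.
Proof. by rewrite [LHS]row_mxEl mxE. Qed.

Lemma rV_consES n (p : R * 'rV[R]_n) (j : 'I_n) :
  rV_cons p ord0 (rshift 1 j) = p.2 ord0 j.
Proof. by rewrite [LHS]row_mxEr. Qed.

Lemma measurable_rV_cons n :
  measurable_fun [set: R * 'rV[R]_n] (@rV_cons n).
Proof.
apply: measurable_fun_rV => i.
rewrite -(splitK (i : 'I_(1 + n))); case: (fintype.split _) => j /=.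
- rewrite [X in measurable_fun _ X](_ : _ = fst) //.
  by apply/funext => p; rewrite rV_consE0.
- rewrite [X in measurable_fun _ X]
    (_ : _ = (fun x : 'rV[R]_n => x ord0 j) \o snd).
    by apply: measurableT_comp => //; exact: measurable_rV_coord.
  by apply/funext => p /=; rewrite rV_consES.
Qed.

Section step.
Context (n : nat) (mu : {sigma_finite_measure set 'rV[R]_n -> \bar R}).

Definition lebesgue_rV_step : set 'rV[R]_n.+1 -> \bar R :=
  pushforward ((@lebesgue_measure R) \x mu) (@rV_cons n).

Let step0 : lebesgue_rV_step set0 = 0.
Proof. by rewrite /lebesgue_rV_step /pushforward preimage_set0 measure0. Qed.

Let step_ge0 A : 0 <= lebesgue_rV_step A.
Proof. by rewrite /lebesgue_rV_step /pushforward measure_ge0. Qed.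

Let step_sigma_additive : semi_sigma_additive lebesgue_rV_step.
Proof.
move=> F mF tF mUF; rewrite /lebesgue_rV_step /pushforward preimage_bigcup.
have mcons A : measurable A -> measurable (@rV_cons n @^-1` A).
  by move=> mA; rewrite -[_ @^-1` _]setTI; exact: measurable_rV_cons.
apply: measure_semi_sigma_additive.
- by move=> k; exact: mcons.
- apply/trivIsetP => /= i j _ _ ij; rewrite -preimage_setI.
  by move/trivIsetP : tF => /(_ _ _ _ _ ij) ->//; rewrite preimage_set0.
- by rewrite -preimage_bigcup; exact: mcons.
Qed.

HB.instance Definition _ := isMeasure.Build _ _ _ lebesgue_rV_step
  step0 step_ge0 step_sigma_additive.

Let step_sigma_finite : sigma_finite setT lebesgue_rV_step.
Proof.
pose uncons (v : 'rV[R]_n.+1) : R * 'rV[R]_n :=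
  (v ord0 ord0, rsubmx (v : 'rV[R]_(1 + n))).
have unconsK : cancel (@rV_cons n) uncons.
  move=> [x v]; congr (_, _); last by rewrite row_mxKr.
  rewrite -[RHS](rV_consE0 (x, v) ord0); congr (rV_cons _ _ _).
  exact/val_inj.
have muncons : measurable_fun setT uncons.
  apply/measurable_fun_pairP; split => /=; first exact: measurable_rV_coord.
  apply: measurable_fun_rV => i /=.
  rewrite [X in measurable_fun _ X](_ : _ =
    fun v : 'rV[R]_n.+1 => v ord0 (rshift 1 i)).
    exact: measurable_rV_coord.
  by apply/funext => v; rewrite mxE.
have /sigma_finiteP[F [TF ndF Foo]] := sigma_finiteT (@lebesgue_measure R).
have /sigma_finiteP[G [TG ndG Goo]] := sigma_finiteT mu.
exists (fun k => uncons @^-1` (F k `*` G k)).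
  rewrite -preimage_bigcup (_ : \bigcup_k _ = setT) ?preimage_setT//.
  apply/seteqP; split => // -[x y] _.
  have [k _ Fkx] : (\bigcup_k F k) x by rewrite -TF.
  have [l _ Gly] : (\bigcup_k G k) y by rewrite -TG.
  exists (maxn k l) => //; split => /=.
  - by move: x Fkx; exact/subsetPset/ndF/leq_maxl.
  - by move: y Gly; exact/subsetPset/ndG/leq_maxr.
move=> k; have [mFk Fkoo] := Foo k; have [mGk Gkoo] := Goo k; split.
  by rewrite -[_ @^-1` _]setTI; apply: muncons => //; exact: measurableX.
rewrite /lebesgue_rV_step /pushforward -comp_preimage.
rewrite (_ : uncons \o _ = id); last by apply/funext => p; exact: unconsK.
by rewrite preimage_id product_measure1E// lte_mul_pinfty// ge0_fin_numE.
Qed.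

HB.instance Definition _ := Measure_isSigmaFinite.Build _ _ _ lebesgue_rV_step
  step_sigma_finite.

End step.

(* Lebesgue measure on R^n, by iterating lambda_(n+1) = lambda \x lambda_n. *)
Fixpoint lebesgue_rV (n : nat) : {sigma_finite_measure set 'rV[R]_n -> \bar R} :=
  match n with
  | 0 => \d_(0%R : 'rV[R]_0)
  | n'.+1 => lebesgue_rV_step (lebesgue_rV n')
  end.

Lemma lebesgue_rV_box n (A : nat -> set R) : (forall i, measurable (A i)) ->
  lebesgue_rV n [set x | forall i : 'I_n, A i (x ord0 i)] =
  \prod_(i < n) lebesgue_measure (A i).
Proof.
elim: n A => [|n IH] A mA.
  by rewrite big_ord0 /= diracE mem_set// => -[].
rewrite big_ord_recl /= /lebesgue_rV_step /pushforward.
pose S := [set x : 'rV[R]_n | forall i : 'I_n, A i.+1 (x ord0 i)].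
rewrite (_ : _ @^-1` _ = A 0%N `*` S).
  have mS : measurable S.
    rewrite (_ : S = \bigcap_(i in [set: 'I_n])
        ((fun x : 'rV[R]_n => x ord0 i) @^-1` A i.+1)).
      apply: fin_bigcap_measurable => // i _; rewrite -[X in measurable X]setTI.
      by apply: measurable_rV_coord => //; exact: mA.
    by apply/seteqP; split => [x H i _|x H i]; [exact: H|exact: (H i I)].
  rewrite product_measure1E; [|exact: mA|exact: mS].
  by congr (_ * _); exact: (IH (fun i => A i.+1)).
apply/seteqP; split => -[x v] /=.
- move=> H; split.
    by have := H (lshift n (ord0 : 'I_1)); rewrite rV_consE0.
  by move=> i; have := H (rshift 1 i); rewrite rV_consES.
- move=> [Hx Hv] i; rewrite -(splitK (i : 'I_(1 + n))).
  case: (fintype.split _) => j /=; last by rewrite rV_consES; exact: Hv.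
  by rewrite (ord1 j) rV_consE0.
Qed.

End lebesgue_rV.

Section multinomial.
Context {R : realType}.

Definition simplex (n : nat) : set 'rV[R]_n :=
  [set t | (forall k, 0 <= t ord0 k <= 1) /\ \sum_k t ord0 k <= 1].

Arguments simplex n : clear implicits.

(* (theta_1, ..., theta_N), with theta_N := 1 - (theta_1 + ... + theta_(N-1)) *)
Definition full_param (N : nat) (t : 'rV[R]_N.-1) (i : 'I_N) : R :=
  if insub (val i) is Some k then t ord0 (k : 'I_N.-1) else 1 - \sum_k t ord0 k.

Definition frontier (T : topologicalType) (D : set T) : set T :=
  closure D `\` interior D.

(* q in C^1(closure D): q is C^1 in the interior of D, and q and its first
   partial derivatives extend continuously to the closure of D. *)
Definition C1_closure (n : nat) (D : set 'rV[R]_n) (q : 'rV[R]_n -> R) : Prop :=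
  {within closure D, continuous q} /\
  forall i : 'I_n, exists g : 'rV[R]_n -> R,
    {within closure D, continuous g} /\
    forall x, interior D x -> is_derive x (delta_mx ord0 i : 'rV[R]_n) q (g x).

Definition full_support (n : nat) (D : set 'rV[R]_n)
    (p : probability 'rV[R]_n R) : Prop :=
  p D = 1%E /\
  forall U, open U -> U `&` D !=set0 -> (0 < p U)%E.

Definition has_density (n : nat) (D : set 'rV[R]_n)
    (p : probability 'rV[R]_n R) (q : 'rV[R]_n -> R) : Prop :=
  (forall t, D t -> 0 <= q t) /\
  forall A, measurable A ->
    p A = (\int[lebesgue_rV n]_(t in A `&` D) (q t)%:E)%E.

Definition euclid_dist (n : nat) (s t : 'rV[R]_n) : R :=
  Num.sqrt (\sum_k (s ord0 k - t ord0 k) ^+ 2).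

Definition coupling (n : nat) (mu nu : set 'rV[R]_n -> \bar R)
    (g : probability ('rV[R]_n * 'rV[R]_n)%type R) : Prop :=
  forall A, measurable A ->
    g (A `*` setT) = mu A /\ g (setT `*` A) = nu A.

Definition wasserstein2 (n : nat) (mu nu : set 'rV[R]_n -> \bar R) : \bar R :=
  ereal_inf [set ((\int[g]_z (euclid_dist z.1 z.2 ^+ 2)%:E) `^ (2^-1))%E
            | g in coupling mu nu].

(* The sample x_1, ..., x_n is x 0, ..., x n.-1. *)
Definition counts (X : finType) (N : nat) (a : 'I_N -> X) (n : nat)
    (x : nat -> X) (i : 'I_N) : nat :=
  (\sum_(j < n) (x j == a i))%N.

Definition likelihood (X : finType) (N : nat) (a : 'I_N -> X) (n : nat)
    (x : nat -> X) (t : 'rV[R]_N.-1) : R :=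
  \prod_(i < N) full_param t i ^+ counts a n x i.

Definition posterior (X : finType) (N : nat) (a : 'I_N -> X)
    (p : probability 'rV[R]_N.-1 R) (n : nat) (x : nat -> X)
    (A : set 'rV[R]_N.-1) : \bar R :=
  ((\int[p]_(t in A `&` simplex N.-1) (likelihood a n x t)%:E) /
   (\int[p]_(t in simplex N.-1) (likelihood a n x t)%:E))%E.

Context {d : measure_display} {Omega : measurableType d}.
Variable P : probability Omega R.

Definition mutually_independent (X : finType) (xi : nat -> Omega -> X) : Prop :=
  forall (J : seq nat) (B : nat -> set X), uniq J ->
    P (\bigcap_(j in [set` J]) xi j @^-1` B j) =
    (\prod_(j <- J) P (xi j @^-1` B j))%E.

Definition iid_multinomial (X : finType) (N : nat) (a : 'I_N -> X)
    (t0 : 'rV[R]_N.-1) (xi : nat -> Omega -> X) : Prop :=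
  [/\ forall j (B : set X), measurable (xi j @^-1` B),
      mutually_independent xi &
      forall j i, P (xi j @^-1` [set a i]) = (full_param t0 i)%:E].

Definition PCR (X : finType) (N : nat) (a : 'I_N -> X)
    (p : probability 'rV[R]_N.-1 R) (t0 : 'rV[R]_N.-1)
    (xi : nat -> Omega -> X) (n : nat) : \bar R :=
  (\int[P]_w wasserstein2 (posterior a p n (xi ^~ w)) (dirac t0))%E.

End multinomial.
Arguments simplex {R} n.

(* Main.v *)
(* The prior density q is bounded by some M on the simplex and by some c > 0 on
   a box around t0, so the posterior is comparable with the posterior of the
   flat prior, a Dirichlet law. By the Dirichlet integral, the second moment V
   of that law around t0 is at most a constant times
   1/n + sum_k (nu_k/n - t0_k)^2. If V is small, Chebyshev's inequality puts
   half of the flat posterior mass in the box, which bounds the evidence from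
   below; if V is not small, the boundedness of the simplex suffices: in both
   cases W_2^2 <= K V, by the product coupling with the Dirac mass. Finally
   E[(nu_k - n t0_k)^2] <= n and sqrt x <= (sqrt n x + 1/sqrt n)/2 yield the
   rate n^(-1/2). *)
From HB Require Import structures.
Require Import Defs.
From mathcomp Require Import all_boot all_order all_algebra.
From mathcomp Require Import all_classical all_reals all_analysis.
From mathcomp Require Import measurable_realfun.
From mathcomp Require Import ring lra.
Import Order.TTheory GRing.Theory Num.Theory.
Import numFieldNormedType.Exports.
Local Open Scope classical_set_scope.
Local Open Scope ring_scope.

(** * Dirichlet integrals *)

(** The obstacle is that [q] vanishes on the boundary, so no multiple of Lebesgue measure lies below
    the prior on the whole simplex: domination from above is global, domination from below holds
    only in a box around [t0]. The numerator of the posterior moment uses the first; the evidence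
    uses the second, provided the flat posterior keeps a fixed share of its mass in the box. When it
    does not, [V] exceeds a fixed threshold, and any bounded loss is at most a constant times [V].
    The bound on W_2^2 is therefore deterministic: [K] is fixed before the sample, every sample is
    covered, and randomness enters only through the variances of the counts. The Dirichlet integral
    is proved on simplices of any size [s], since slicing along a coordinate changes the size. All
    integrals are kept nonnegative, and comparisons go through monotonicity in the measure or in the
    integrand, so the measurability of [q] and of the Wasserstein distance as a function of the
    sample never has to be established. *)

Lemma integral_deriv_poly {R : realType} (F : {poly R}) (s : R) : 0 <= s ->
  (\int[lebesgue_measure]_(x in `[0%R, s]) (F^`().[x])%:E = (F.[s] - F.[0])%:E)%E.
Proof.
rewrite le_eqVlt => /predU1P[<-|s0].
  by rewrite set_itv1 integral_set1 subrr.
have dF x : is_derive x (1 : R) (horner F) F^`().[x] by exact: is_derive_poly.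
rewrite (@continuous_FTC2 _ (horner F^`()) (horner F))// ?EFinB//.
- by apply: continuous_subspaceT => x; exact: continuous_horner.
- split; [|apply: cvg_at_right_filter|apply: cvg_at_left_filter];
    [|exact: continuous_horner..].
  by move=> x _; have [] := dF x.
- by move=> x _; rewrite derive1E; have [] := dF x.
Qed.

(** An explicit polynomial antiderivative reduces the beta integral to the fundamental theorem of
    calculus. The induction on [a] keeps [b] general, because the pair [(a + 1, b)] is reduced to
    [(a, b + 1)]. *)
Lemma beta_antiderivative {R : realType} (s : R) (a b : nat) :
  exists F : {poly R},
    [/\ F^`() = 'X^a * (s%:P - 'X) ^+ b, F.[0] = 0 &
        F.[s] = s ^+ (a + b).+1 * (a`! * b`!)%:R / (a + b).+1`!%:R].
Proof.
have n0 (n : nat) : n.+1%:R != 0 :> R by rewrite pnatr_eq0.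
have f0 (n : nat) : n`!%:R != 0 :> R by rewrite pnatr_eq0 -lt0n fact_gt0.
have cK (n : nat) : (n.+1%:R^-1)%:P * n.+1%:R = 1 :> {poly R}.
  by rewrite -polyC_natr -polyCM mulVf.
elim: a b => [|a IH] b.
  exists (b.+1%:R^-1 *: ((s ^+ b.+1)%:P - (s%:P - 'X) ^+ b.+1)); split.
  - rewrite derivZ derivB derivC deriv_exp derivB derivC derivX /= expr0 mul1r.
    rewrite !sub0r mulN1r mulNrn opprK -(mulr_natl (_ ^+ b)) -mul_polyC mulrA.
    by rewrite [X in X * _](cK b) mul1r.
  - by rewrite hornerZ hornerD hornerC hornerN horner_exp !hornerE/= subr0 subrr mulr0.
  - rewrite hornerZ hornerD hornerC hornerN horner_exp !hornerE/= subrr expr0n subr0 factS natrM.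
    by field; rewrite f0 nat1r n0.
have [F [dF F0 Fs]] := IH b.+1.
(* integration by parts *)
exists (b.+1%:R^-1 *: (a.+1%:R *: F - 'X^(a.+1) * (s%:P - 'X) ^+ b.+1)); split.
- rewrite derivZ derivB derivZ dF derivM derivXn deriv_exp derivB derivC derivX /=.
  rewrite -!mul_polyC polyC_natr !exprS -(mulr_natr (_ * (_ - _) ^+ b)).
  set c := (X in X * _ = _); have : c * b.+1%:R = 1 by exact: cK.
  move: c b.+1%:R => c d cK1; ring: cK1.
- by rewrite hornerZ hornerD hornerN hornerM hornerXn hornerZ F0 expr0n/= mul0r mulr0 subrr mulr0.
- rewrite hornerZ hornerD hornerN hornerM horner_exp hornerZ !hornerE/= subrr expr0n mulr0 subr0 Fs addSnnS !factS !natrM.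
  by field; rewrite !nat1r -natrD nat1r !f0 !n0.
Qed.

Lemma beta_integral {R : realType} (s : R) (a b : nat) : 0 <= s ->
  (\int[lebesgue_measure]_(x in `[0%R, s]) (x ^+ a * (s - x) ^+ b)%:E =
   (s ^+ (a + b).+1 * (a`! * b`!)%:R / (a + b).+1`!%:R)%:E)%E.
Proof.
move=> s0; have [F [dF F0 <-]] := beta_antiderivative s a b.
rewrite -[in RHS](subr0 F.[s]) -[in RHS]F0 -integral_deriv_poly//.
by apply: eq_integral => x _; rewrite dF !hornerE.
Qed.

(** The size is variable because fixing a first coordinate [x] leaves a simplex of size [s - x]. *)
Definition scaled_simplex {R : realType} (n : nat) (s : R) : set 'rV[R]_n :=
  [set t | (forall k, 0 <= t ord0 k) /\ \sum_k t ord0 k <= s].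

(** Unnormalised Dirichlet density. The exponent [m] belongs to the slack, which for [s = 1] is the
    probability of the last category. *)
Definition dirichlet_monomial {R : realType} {n : nat} (nu : 'I_n -> nat)
    (m : nat) (s : R) (t : 'rV[R]_n) : R :=
  (\prod_i t ord0 i ^+ nu i) * (s - \sum_k t ord0 k) ^+ m.

Lemma simplexE {R : realType} (n : nat) :
  simplex n = scaled_simplex n (1 : R).
Proof.
apply/seteqP; split => t [t0 t1]; split => // k.
- by have /andP[] := t0 k.
- rewrite t0 /=; apply: le_trans t1; rewrite (bigD1 k)//= lerDl.
  by apply: sumr_ge0 => i _; exact: t0.
Qed.

Lemma measurable_sum_coord {R : realType} (n : nat) :
  measurable_fun setT (fun t : 'rV[R]_n => \sum_k t ord0 k).
Proof. by apply: measurable_sum => k; exact: measurable_rV_coord. Qed.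

Lemma measurable_scaled_simplex {R : realType} (n : nat) (s : R) :
  measurable (scaled_simplex n s).
Proof.
rewrite (_ : scaled_simplex n s =
    \bigcap_(k in [set: 'I_n]) ((fun t : 'rV[R]_n => t ord0 k) @^-1` `[0, +oo[) `&`
    ((fun t : 'rV[R]_n => \sum_k t ord0 k) @^-1` `]-oo, s])).
  apply: measurableI.
    apply: fin_bigcap_measurable => // k _; rewrite -[X in measurable X]setTI.
    by apply: measurable_rV_coord.
  by rewrite -[X in measurable X]setTI; exact: measurable_sum_coord.
apply/seteqP; split => t /=.
- move=> [t0 ts]; split; last by rewrite in_itv.
  by move=> k _ /=; rewrite in_itv/= t0.
- move=> [t0 ts]; split; last by move: ts; rewrite in_itv.
  by move=> k; have := t0 k I; rewrite /= in_itv/= andbT.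
Qed.

Lemma measurable_dirichlet_monomial {R : realType} (n : nat) (nu : 'I_n -> nat)
    (m : nat) (s : R) :
  measurable_fun setT (dirichlet_monomial nu m s).
Proof.
apply: measurable_funM.
  by apply: measurable_prod => i _; apply: measurable_funX; exact: measurable_rV_coord.
apply: measurable_funX; apply: measurable_funB => //; exact: measurable_sum_coord.
Qed.

Lemma dirichlet_monomial_ge0 {R : realType} (n : nat) (nu : 'I_n -> nat)
    (m : nat) (s : R) (t : 'rV[R]_n) :
  scaled_simplex n s t -> 0 <= dirichlet_monomial nu m s t.
Proof.
move=> [t0 ts]; rewrite mulr_ge0 ?exprn_ge0 ?subr_ge0//.
by apply: prodr_ge0 => i _; rewrite exprn_ge0.
Qed.

(** Tonelli through the pushforward that defines [lebesgue_rV]. Nonnegativity is asked on the whole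
    space, so an integral over a simplex is first extended by zero. *)
Lemma integral_lebesgue_rV_cons {R : realType} (n : nat) (f : 'rV[R]_n.+1 -> \bar R) :
  measurable_fun setT f -> (forall t, 0 <= f t)%E ->
  (\int[lebesgue_rV n.+1]_t f t =
   \int[lebesgue_measure]_x \int[lebesgue_rV n]_v f (rV_cons (x, v)))%E.
Proof.
move=> mf f0.
have := @ge0_integral_pushforward _ _ (measurableTypeR R * 'rV[R]_n)%type _ R _
  (@measurable_rV_cons R n) (lebesgue_measure \x lebesgue_rV n)%E setT f
  measurableT mf (fun y _ => f0 y).
rewrite preimage_setT => ->.
rewrite -(@fubini_tonelli1 _ _ (measurableTypeR R) 'rV[R]_n R lebesgue_measure
  (lebesgue_rV n) (fun z => f (rV_cons z)))//.
by apply: measurableT_comp => //; exact: measurable_rV_cons.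
Qed.

Lemma dirichlet_monomial_cons {R : realType} (n : nat) (nu : 'I_n.+1 -> nat)
    (m : nat) (s x : R) (v : 'rV[R]_n) :
  dirichlet_monomial nu m s (rV_cons (x, v)) =
  x ^+ nu ord0 * dirichlet_monomial (fun i => nu (lift ord0 i)) m (s - x) v.
Proof.
rewrite /dirichlet_monomial !big_ord_recl.
have -> : rV_cons (x, v) ord0 ord0 = x.
  rewrite -[RHS](rV_consE0 (x, v) ord0); congr (rV_cons _ _ _); exact: val_inj.
have E i : rV_cons (x, v) ord0 (lift ord0 i) = v ord0 i.
  rewrite -[RHS](rV_consES (x, v)); congr (rV_cons _ _ _); exact: val_inj.
rewrite mulrA opprD addrA; congr (_ * _ * (_ - _) ^+ _);
  by apply: eq_bigr => i _; rewrite E.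
Qed.

Lemma scaled_simplex_cons {R : realType} (n : nat) (s x : R) (v : 'rV[R]_n) :
  scaled_simplex n.+1 s (rV_cons (x, v)) <->
  0 <= x /\ scaled_simplex n (s - x) v.
Proof.
have E0 : rV_cons (x, v) ord0 ord0 = x.
  rewrite -[RHS](rV_consE0 (x, v) ord0); congr (rV_cons _ _ _); exact: val_inj.
have E i : rV_cons (x, v) ord0 (lift ord0 i) = v ord0 i.
  rewrite -[RHS](rV_consES (x, v)); congr (rV_cons _ _ _); exact: val_inj.
have ES : \sum_k rV_cons (x, v) ord0 k = x + \sum_k v ord0 k.
  by rewrite big_ord_recl E0; congr (_ + _); apply: eq_bigr => i _; rewrite E.
rewrite /scaled_simplex /= ES lerBrDl; split.
- move=> [v0 vs]; split; first by rewrite -E0.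
  by split => // k; rewrite -E.
- move=> [x0 [v0 vs]]; split => // k.
  case: (unliftP ord0 k) => [j ->|->]; first by rewrite E.
  by rewrite E0.
Qed.

(** Slicing along the first coordinate [x], the induction hypothesis makes the inner integral a
    multiple of [(s - x) ^+ S], and the outer one is a beta integral. The factorial of [S] that it
    produces cancels the denominator of [K]. *)
Lemma dirichlet_integral {R : realType} (n : nat) (nu : 'I_n -> nat) (m : nat)
    (s : R) : 0 <= s ->
  (\int[lebesgue_rV n]_(t in scaled_simplex n s)
     (dirichlet_monomial nu m s t)%:E =
   (s ^+ (\sum_i nu i + m + n) * ((\prod_i (nu i)`!) * m`!)%:R
      / (\sum_i nu i + m + n)`!%:R)%:E)%E.
Proof.
elim: n nu m s => [|n IH] nu m s s0.
  rewrite integral_dirac//; last 2 first.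
    exact: measurable_scaled_simplex.
    apply/measurable_EFinP; apply: measurable_funTS.
    exact: measurable_dirichlet_monomial.
  rewrite /dirac indicE mem_set; last by split; [case|rewrite big_ord0].
  rewrite mul1e /dirichlet_monomial !big_ord0 subr0 !mul1r mul1n add0n addn0.
  by rewrite mulfK// pnatr_eq0 -lt0n fact_gt0.
rewrite integral_mkcond integral_lebesgue_rV_cons; last 2 first.
- apply: (measurable_restrictT _ (measurable_scaled_simplex n.+1 s)).1.
  apply/measurable_EFinP; apply: measurable_funTS.
  exact: measurable_dirichlet_monomial.
- move=> t; apply: erestrict_ge0 => u Cu; rewrite lee_fin.
  exact: dirichlet_monomial_ge0.
pose nu' i := nu (lift ord0 i).
pose S := (\sum_i nu' i + m + n)%N.
pose K : R := ((\prod_i (nu' i)`!) * m`!)%:R / S`!%:R.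
transitivity (\int[lebesgue_measure]_(x in `[0%R, s])
    (K%:E * (x ^+ nu ord0 * (s - x) ^+ S)%:E))%E.
  rewrite [RHS]integral_mkcond; apply: eq_integral => x _.
  rewrite [RHS]/patch; case: ifPn => xs.
    have [x0 xs'] : 0 <= x /\ 0 <= s - x.
      by move: xs; rewrite inE/= in_itv/= subr_ge0 => /andP.
    transitivity (\int[lebesgue_rV n]_(v in scaled_simplex n (s - x))
      ((x ^+ nu ord0)%:E * (dirichlet_monomial nu' m (s - x) v)%:E))%E.
      rewrite [RHS]integral_mkcond; apply: eq_integral => v _.
      rewrite /patch dirichlet_monomial_cons -EFinM.
      by congr (if _ then _ else _); apply/idP/idP; rewrite !inE scaled_simplex_cons => //-[].
    rewrite ge0_integralZl_EFin//; last 4 first.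
    - exact: measurable_scaled_simplex.
    - by move=> v Cv; rewrite lee_fin; exact: dirichlet_monomial_ge0.
    - apply/measurable_EFinP; apply: measurable_funTS.
      exact: measurable_dirichlet_monomial.
    - by rewrite exprn_ge0.
    by rewrite IH// -!EFinM /K /S; congr EFin; ring.
  (* Outside [[0, s]] the slice is empty: a point in it would force [0 <= x] and [0 <= s - x]. *)
  rewrite integral0_eq// => v _; rewrite /patch; case: ifPn => //.
  rewrite inE => /scaled_simplex_cons[x0 [v0 vs]].
  move: xs; rewrite notin_setE/= in_itv/= x0 -subr_ge0 => /negP.
  by rewrite (le_trans _ vs)// sumr_ge0.
rewrite ge0_integralZl_EFin//; last 3 first.
- move=> x; rewrite /= in_itv/= => /andP[x0 xs].
  by rewrite lee_fin mulr_ge0// exprn_ge0// subr_ge0.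
- apply/measurable_EFinP; apply: measurable_funTS; apply: measurable_funM.
    exact: measurable_funX.
  by apply: measurable_funX; apply: measurable_funB.
- by rewrite divr_ge0.
rewrite beta_integral// -EFinM !big_ord_recl.
(* The successor coming from the outer integration turns the dimension [n] inside [S] into
   [n.+1]. *)
rewrite -!addnA -/nu' (_ : (nu ord0 + S).+1 = (nu ord0 + (\sum_i nu' i + (m + n.+1)))%N); last first.
  by rewrite /S !addnA addnS.
congr EFin; rewrite /K !natrM; field.
by rewrite !pnatr_eq0 -!lt0n !fact_gt0.
Qed.

(** * Posterior moments *)

(** Multivariate beta function at the parameters [nu i + 1] and [m + 1], that is, the evidence under
    the flat prior. *)
Definition dirichlet_const {n : nat} (nu : 'I_n -> nat) (m : nat) (R : realType) : R :=
  ((\prod_i (nu i)`!) * m`!)%:R / (\sum_i nu i + m + n)`!%:R.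

(* The exponents of the monomial multiplied by the k-th coordinate. *)
Definition incr_at {n : nat} (k : 'I_n) (nu : 'I_n -> nat) (i : 'I_n) : nat :=
  ((i == k) + nu i)%N.

Lemma dirichlet_const_gt0 {R : realType} {n : nat} (nu : 'I_n -> nat) (m : nat) :
  0 < dirichlet_const nu m R.
Proof.
rewrite divr_gt0 ?ltr0n ?fact_gt0// muln_gt0 fact_gt0 andbT.
by apply: prodn_gt0 => i; exact: fact_gt0.
Qed.

Lemma sum_incr_at {n : nat} (k : 'I_n) (nu : 'I_n -> nat) :
  (\sum_i incr_at k nu i = (\sum_i nu i).+1)%N.
Proof.
rewrite big_split/= -add1n; congr addn.
by rewrite -big_mkcond/= big_pred1_eq.
Qed.

(** The extra factor is the mean of the [k]-th coordinate under the Dirichlet law with these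
    parameters. *)
Lemma dirichlet_const_incr {R : realType} {n : nat} (k : 'I_n)
    (nu : 'I_n -> nat) (m : nat) :
  dirichlet_const (incr_at k nu) m R =
  dirichlet_const nu m R * ((nu k).+1%:R / (\sum_i nu i + m + n).+1%:R).
Proof.
rewrite /dirichlet_const sum_incr_at !addSn.
have -> : (\prod_i (incr_at k nu i)`! = (nu k).+1 * \prod_i (nu i)`!)%N.
  rewrite (bigD1 k)//= [in RHS](bigD1 k)//= /incr_at eqxx add1n factS -mulnA.
  by congr (_ * (_ * _))%N; apply: eq_bigr => i /negbTE ->.
rewrite factS !natrM; field.
by rewrite -!natrD nat1r !pnatr_eq0 -!lt0n fact_gt0.
Qed.

Lemma dirichlet_monomial_incr {R : realType} {n : nat} (k : 'I_n)
    (nu : 'I_n -> nat) (m : nat) (s : R) (t : 'rV[R]_n) :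
  dirichlet_monomial (incr_at k nu) m s t = t ord0 k * dirichlet_monomial nu m s t.
Proof.
rewrite /dirichlet_monomial mulrA; congr (_ * _).
rewrite (bigD1 k)//= [in RHS](bigD1 k)//= /incr_at eqxx add1n exprS -mulrA.
by congr (_ * (_ * _)); apply: eq_bigr => i /negbTE ->.
Qed.

Lemma integral_dirichlet_monomial {R : realType} {n : nat} (nu : 'I_n -> nat)
    (m : nat) :
  (\int[lebesgue_rV n]_(t in simplex n) (dirichlet_monomial nu m 1 t)%:E =
   (dirichlet_const nu m R)%:E)%E.
Proof. by rewrite simplexE dirichlet_integral// expr1n mul1r. Qed.

(** Squared bias plus variance of a Beta variable with mean [u / (S + 1)]. Multiplying by a
    coordinate only raises an exponent, so expanding the square leaves three Dirichlet integrals;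
    [0 <= c] makes the cross term nonnegative. *)
Lemma dirichlet_second_moment {R : realType} {n : nat} (nu : 'I_n -> nat)
    (m : nat) (k : 'I_n) (c : R) : 0 <= c ->
  let S : R := (\sum_i nu i + m + n)%:R in let u : R := (nu k)%:R + 1 in
  (\int[lebesgue_rV n]_(t in simplex n)
     ((t ord0 k - c) ^+ 2 * dirichlet_monomial nu m 1 t)%:E =
   (dirichlet_const nu m R *
     ((u / (S + 1) - c) ^+ 2 + u * (S + 1 - u) / ((S + 1) ^+ 2 * (S + 2))))%:E)%E.
Proof.
move=> c0 S u.
set I := (X in X = _).
have mS : measurable (simplex n : set 'rV[R]_n).
  by rewrite simplexE; exact: measurable_scaled_simplex.
have mdm mu' : measurable_fun (simplex n)
    (fun t : 'rV[R]_n => (dirichlet_monomial mu' m 1 t)%:E).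
  apply/measurable_EFinP; apply: measurable_funTS.
  exact: measurable_dirichlet_monomial.
have dm0 mu' t : simplex n t -> 0 <= dirichlet_monomial mu' m (1 : R) t.
  by rewrite simplexE => /dirichlet_monomial_ge0.
(* The cross term stays on the left, so that all integrands are nonnegative. *)
have IE : (I + (2 * c)%:E * (dirichlet_const (incr_at k nu) m R)%:E =
    (dirichlet_const (incr_at k (incr_at k nu)) m R)%:E +
    (c ^+ 2)%:E * (dirichlet_const nu m R)%:E)%E.
  rewrite -!integral_dirichlet_monomial -!ge0_integralZl_EFin ?mulr_ge0 ?exprn_ge0//; try exact: dm0.
  have dmZ0 (a : R) mu' t : 0 <= a -> simplex n t ->
      (0 <= a%:E * (dirichlet_monomial mu' m 1 t)%:E)%E.
    by move=> a0 St; rewrite mule_ge0// lee_fin dm0.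
  rewrite -!ge0_integralD//.
  - apply: eq_integral => t _; rewrite !dirichlet_monomial_incr -!EFinM -!EFinD.
    by congr EFin; ring.
  - by move=> t St; rewrite lee_fin dm0.
  - by move=> t St; rewrite dmZ0 ?exprn_ge0.
  - exact: measurable_funeM.
  - by move=> t St; rewrite lee_fin mulr_ge0 ?sqr_ge0 ?dm0.
  - apply/measurable_EFinP; apply: measurable_funM; last first.
      by apply: measurable_funTS; exact: measurable_dirichlet_monomial.
    apply: measurable_funX; apply: measurable_funB => //; apply: measurable_funTS.
    exact: measurable_rV_coord.
  - by move=> t St; rewrite dmZ0 ?mulr_ge0.
  - exact: measurable_funeM.
have {IE} -> : I = ((dirichlet_const (incr_at k (incr_at k nu)) m R) +
    (c ^+ 2) * (dirichlet_const nu m R) - (2 * c) * (dirichlet_const (incr_at k nu) m R))%:E.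
  move: IE; rewrite -!EFinM -EFinD EFinB => <-.
  by rewrite addeK.
congr EFin; rewrite !dirichlet_const_incr sum_incr_at /incr_at eqxx add1n.
have E1 : (nu k).+1%:R = u by rewrite /u natr1.
have E2 : (nu k).+2%:R = u + 1 by rewrite /u !natr1.
have E3 : (\sum_i nu i + m + n).+1%:R = S + 1 by rewrite /S natr1.
have E4 : (\sum_i nu i + m + n).+2%:R = S + 2 by rewrite /S -[2]/(2%:R) -natrD addn2.
rewrite !addSn E1 E2 E3 E4; field.
have S0 : 0 <= S by rewrite ler0n.
by rewrite !lt0r_neq0 ?ltr_wpDl.
Qed.

(** The flat prior acts as one extra observation per category, which shifts the bias by O(1/N). In
    the constant, [2 * n.+2%:R ^+ 2] pays for the square of this shift and 1 for the variance. *)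
Lemma dirichlet_second_moment_le {R : realType} {n : nat} (nu : 'I_n -> nat)
    (m : nat) (k : 'I_n) (c : R) : 0 <= c <= 1 ->
  let N : nat := (\sum_i nu i + m)%N in (0 < N)%N ->
  (\int[lebesgue_rV n]_(t in simplex n)
     ((t ord0 k - c) ^+ 2 * dirichlet_monomial nu m 1 t)%:E <=
   (dirichlet_const nu m R * (2 * ((nu k)%:R - N%:R * c) ^+ 2 / N%:R ^+ 2
      + (2 * n.+2%:R ^+ 2 + 1) / N%:R))%:E)%E.
Proof.
move=> /andP[c0 c1] N N0; rewrite dirichlet_second_moment// lee_fin.
rewrite ler_pM2l ?dirichlet_const_gt0//.
have x0 : 1 <= N%:R :> R by rewrite ler1n.
have uN : (nu k)%:R <= N%:R :> R.
  by rewrite ler_nat /N (bigD1 k)//= -addnA leq_addr.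
rewrite natrD.
have v0 : 0 <= (nu k)%:R :> R by rewrite ler0n.
have n0 : 0 <= n%:R :> R by rewrite ler0n.
have -> : n.+2%:R = n%:R + 2 :> R by rewrite -[2]/(2%:R) -natrD addn2.
move: x0 uN v0 n0; rewrite -/N; move: (N%:R : R) (n%:R : R) ((nu k)%:R : R) => x y v x1 vx v0 y0.
have x0 : 0 < x by exact: lt_le_trans x1.
have T0 : 0 < x + y + 1 by lra.
(* The right-hand side is regrouped so that its first fraction bounds the squared bias and [x^-1]
   the variance. *)
have -> : 2 * (v - x * c) ^+ 2 / x ^+ 2 + (2 * (y + 2) ^+ 2 + 1) / x =
   (2 * (v - x * c) ^+ 2 + 2 * (y + 2) ^+ 2 * x) / x ^+ 2 + x^-1.
  by field; rewrite lt0r_neq0.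
apply: lerD.
  have -> : (v + 1) / (x + y + 1) - c = (v + 1 - c * (x + y + 1)) / (x + y + 1).
    by field; rewrite lt0r_neq0.
  rewrite expr_div_n; apply: ler_pM; rewrite ?sqr_ge0 ?invr_ge0 ?sqr_ge0//.
    have -> : v + 1 - c * (x + y + 1) = (v - x * c) + (1 - c * (y + 1)) by ring.
    apply: (@le_trans _ _ (2 * (v - x * c) ^+ 2 + 2 * (1 - c * (y + 1)) ^+ 2)).
      rewrite -subr_ge0.
      have -> : 2 * (v - x * c) ^+ 2 + 2 * (1 - c * (y + 1)) ^+ 2 - (v - x * c + (1 - c * (y + 1))) ^+ 2 = ((v - x * c) - (1 - c * (y + 1))) ^+ 2 by ring.
      exact: sqr_ge0.
    rewrite lerD2l.
    have : (1 - c * (y + 1)) ^+ 2 <= (y + 2) ^+ 2.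
      rewrite -subr_ge0 subr_sqr mulr_ge0//; nra.
    have : 0 <= (y + 2) ^+ 2 by exact: sqr_ge0.
    move: (_ ^+ 2) ((y + 2) ^+ 2) => A B; nra.
  rewrite lef_pV2 ?posrE ?exprn_gt0// lerXn2r ?nnegrE//; lra.
rewrite ler_pdivrMr ?mulr_gt0 ?exprn_gt0//; last by lra.
rewrite ler_pdivlMl// [leRHS]mulrC; apply: ler_pM; [lra|nra|lra|].
rewrite -subr_ge0.
(* Completing the square in [v + 1]. *)
have -> : (x + y + 1) ^+ 2 - (v + 1) * (x + y + 1 - (v + 1)) =
  (v + 1 - (x + y + 1) / 2) ^+ 2 + 3 / 4 * (x + y + 1) ^+ 2 by field.
by rewrite addr_ge0 ?sqr_ge0// mulr_ge0 ?sqr_ge0//; lra.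
Qed.

(** * The likelihood as a Dirichlet monomial, and the geometry of the simplex *)

Lemma full_param_widen {R : realType} (n : nat) (t : 'rV[R]_n) (k : 'I_n) :
  @full_param R n.+1 t (widen_ord (leqnSn n) k) = t ord0 k.
Proof. by rewrite /full_param /= insubT//= => H; congr (t _ _); exact: val_inj. Qed.

Lemma full_param_max {R : realType} (n : nat) (t : 'rV[R]_n) :
  @full_param R n.+1 t ord_max = 1 - \sum_k t ord0 k.
Proof. by rewrite /full_param /= insubF//= ltnn. Qed.

Lemma likelihoodE {R : realType} (X : finType) (n : nat) (a : 'I_n.+1 -> X)
    (N : nat) (x : nat -> X) :
  likelihood (R := R) a N x = dirichlet_monomial
    (fun k => counts a N x (widen_ord (leqnSn n) k)) (counts a N x ord_max) 1.
Proof.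
apply/funext => t; rewrite /likelihood /dirichlet_monomial big_ord_recr /=.
rewrite full_param_max; congr (_ * _).
by apply: eq_bigr => k _; rewrite full_param_widen.
Qed.

(** After exchanging the sums, each draw contributes exactly one, at the index given by the inverse
    of [a]. *)
Lemma sum_counts (X : finType) (n : nat) (a : 'I_n -> X) (N : nat)
    (x : nat -> X) : bijective a -> (\sum_i counts a N x i = N)%N.
Proof.
move=> [b ab ba]; rewrite exchange_big /= -[RHS](card_ord N) -sum1_card.
apply: eq_bigr => j _; rewrite (bigD1 (b (x j)))//= ba eqxx big1 ?addn0// => i.
by move=> /eqP ib; case: eqP => // xa; case: ib; rewrite xa ab.
Qed.

Lemma simplex_dist_le {R : realType} (n : nat) (s t : 'rV[R]_n) :
  simplex n s -> simplex n t -> \sum_k (s ord0 k - t ord0 k) ^+ 2 <= n%:R.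
Proof.
move=> [s01 _] [t01 _]; rewrite -[leRHS]mul1r -[in leRHS](card_ord n) mulr_natr -sumr_const.
apply: ler_sum => k _; have := s01 k; have := t01 k => /andP[? ?] /andP[? ?]; nra.
Qed.

(** A box suits both uses: balls of row vectors are entrywise, and leaving it means that a single
    coordinate is off by at least [r]. *)
Definition simplex_box {R : realType} {n : nat} (t0 : 'rV[R]_n) (r : R) :
    set 'rV[R]_n :=
  [set t | simplex n t /\ forall k, `|t ord0 k - t0 ord0 k| < r].

Lemma measurable_simplex {R : realType} {n : nat} : measurable (simplex n : set 'rV[R]_n).
Proof. by rewrite simplexE; exact: measurable_scaled_simplex. Qed.

Lemma measurable_simplex_box {R : realType} {n : nat} (t0 : 'rV[R]_n) (r : R) :
  measurable (simplex_box t0 r).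
Proof.
rewrite (_ : simplex_box t0 r = simplex n `&` \bigcap_(k in [set: 'I_n])
    ((fun t : 'rV[R]_n => t ord0 k) @^-1` ball (t0 ord0 k) r)); last first.
  apply/seteqP; split => t [St tr]; split => // k; last first.
    by rewrite distrC; have := tr k I; rewrite /= -ball_normE.
  by move=> _; rewrite /= -ball_normE /= distrC.
apply: measurableI; first exact: measurable_simplex.
apply: fin_bigcap_measurable => // k _; rewrite -[X in measurable X]setTI.
by apply: measurable_rV_coord => //; exact: measurable_ball.
Qed.

(** * From the flat prior to a prior comparable with it *)

Section posterior_moment.
Context {R : realType} {n : nat} (p : {measure set 'rV[R]_n -> \bar R}).
Variables (M c r : R) (t0 : 'rV[R]_n).
Hypotheses (M0 : 0 <= M) (c0 : 0 < c) (r0 : 0 < r) (St0 : simplex n t0).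
Let box : set 'rV[R]_n := simplex_box t0 r.
Hypothesis p_le : forall A, measurable A -> (p A <= M%:E * lebesgue_rV n A)%E.
Hypothesis p_ge : forall A, measurable A -> A `<=` box ->
  (c%:E * lebesgue_rV n A <= p A)%E.

Let d2 (t : 'rV[R]_n) : R := \sum_k (t ord0 k - t0 ord0 k) ^+ 2.

Let measurable_box : measurable box.
Proof. exact: measurable_simplex_box. Qed.

Lemma measurable_sqdist : measurable_fun setT d2.
Proof.
apply: measurable_sum => k; apply: measurable_funX; apply: measurable_funB => //.
exact: measurable_rV_coord.
Qed.

(** Monotonicity of the integral in the measure, applied to the setwise bound [p_le]. *)
Lemma integral_simplex_le (f : 'rV[R]_n -> \bar R) : measurable_fun setT f ->
  (forall t, simplex n t -> 0 <= f t)%E ->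
  (\int[p]_(t in simplex n) f t <= M%:E * \int[lebesgue_rV n]_(t in simplex n) f t)%E.
Proof.
move=> mf f0; have mS := @measurable_simplex R n.
pose M' := NngNum M0.
rewrite -(ge0_integral_mscale _ _ M')//; last exact: measurable_funTS.
rewrite [leLHS]integral_mkcond [leRHS]integral_mkcond.
apply: ge0_le_measure_integral => //.
- by move=> t; apply: erestrict_ge0 => u; exact: f0.
- by apply: (measurable_restrictT _ mS).1; exact: measurable_funTS.
Qed.

(** The lower bound [p_ge] concerns subsets of the box only. Restricting Lebesgue measure to the box
    makes it valid for all measurable sets, and the integral is monotone in the measure. *)
Let integral_p_ge (f : 'rV[R]_n -> \bar R) : measurable_fun setT f ->
  (forall t, simplex n t -> 0 <= f t)%E ->
  (c%:E * \int[lebesgue_rV n]_(t in box) f t <= \int[p]_(t in simplex n) f t)%E.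
Proof.
move=> mf f0; have mS := @measurable_simplex R n.
have boxS : box `<=` simplex n by move=> t [].
apply: (@le_trans _ _ (\int[p]_(t in box) f t)%E); last first.
  by apply: ge0_subset_integral => //; exact: measurable_funTS.
pose c' := NngNum (ltW c0).
have -> : (c%:E * \int[lebesgue_rV n]_(t in box) f t =
    \int[mscale c' (mrestr (lebesgue_rV n) measurable_box)]_(t in box) f t)%E.
  rewrite ge0_integral_mscale//; last 2 first.
  - exact: measurable_funTS.
  - by move=> t /boxS; exact: f0.
  congr (_ * _)%E; apply: eq_measure_integral => A mA AB.
  by rewrite /= /mrestr setIidl.
rewrite [leLHS]integral_mkcond [leRHS]integral_mkcond.
apply: ge0_le_measure_integral => //.
- move=> A mA; apply: (@le_trans _ _ (p (A `&` box))).
    by apply: p_ge; [exact: measurableI|exact: subIsetr].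
  by apply: le_measure; rewrite ?inE//; exact: measurableI.
- by move=> t; apply: erestrict_ge0 => u /boxS; exact: f0.
- by apply: (measurable_restrictT _ measurable_box).1; exact: measurable_funTS.
Qed.

Section bound.
Variables (nu : 'I_n -> nat) (m : nat).
Let N : nat := (\sum_i nu i + m)%N.
Hypothesis N0 : (0 < N)%N.
Let L := dirichlet_monomial nu m (1 : R).

Let W : R := \sum_k (2 * ((nu k)%:R - N%:R * t0 ord0 k) ^+ 2 / N%:R ^+ 2
      + (2 * n.+2%:R ^+ 2 + 1) / N%:R).

Let L0 t : simplex n t -> 0 <= L t.
Proof. by rewrite simplexE; exact: dirichlet_monomial_ge0. Qed.

Let mL : measurable_fun setT L.
Proof. exact: measurable_dirichlet_monomial. Qed.

Let d20 t : 0 <= d2 t.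
Proof. by apply: sumr_ge0 => k _; exact: sqr_ge0. Qed.

Let W0 : 0 <= W.
Proof.
apply: sumr_ge0 => k _; apply: addr_ge0; apply: divr_ge0; rewrite ?sqr_ge0//.
by apply: mulr_ge0 => //; exact: sqr_ge0.
Qed.

Let flat_moment : (\int[lebesgue_rV n]_(t in simplex n) (d2 t * L t)%:E <=
  (dirichlet_const nu m R * W)%:E)%E.
Proof.
have mS := @measurable_simplex R n.
under eq_integral do rewrite /d2 mulr_suml -sumEFin.
rewrite ge0_integral_sum//; last 2 first.
- move=> k; apply/measurable_EFinP; apply: measurable_funTS.
  apply: measurable_funM => //; apply: measurable_funX; apply: measurable_funB => //.
  exact: measurable_rV_coord.
- by move=> k t St; rewrite lee_fin mulr_ge0 ?sqr_ge0 ?L0.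
rewrite /W mulr_sumr -sumEFin; apply: lee_sum => k _.
by apply: dirichlet_second_moment_le => //; have [] := St0.
Qed.

(** The two summands of the constant serve the two cases, [2 * M / c] for small [W] and
    [2 * n%:R / r ^+ 2] for large [W]. Neither depends on [nu] or [m]. *)
Lemma posterior_second_moment_le :
  (\int[p]_(t in simplex n) (d2 t * L t)%:E <=
   ((2 * M / c + 2 * n%:R / r ^+ 2) * W)%:E * \int[p]_(t in simplex n) (L t)%:E)%E.
Proof.
have mS := @measurable_simplex R n.
have mL' : measurable_fun setT (fun t => (L t)%:E) by exact/measurable_EFinP.
have md2L : measurable_fun setT (fun t => (d2 t * L t)%:E).
  by apply/measurable_EFinP; apply: measurable_funM => //; exact: measurable_sqdist.
have d2L0 t : simplex n t -> 0 <= d2 t * L t.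
  by move=> St; rewrite mulr_ge0 ?L0.
have D0 : (0 <= \int[p]_(t in simplex n) (L t)%:E)%E.
  by apply: integral_ge0 => t St; rewrite lee_fin L0.
have r20 : 0 < r ^+ 2 by rewrite exprn_gt0.
have := flat_moment; set Z := dirichlet_const nu m R => flatZ.
have Z0 : 0 < Z by exact: dirichlet_const_gt0.
(* Chebyshev if W is small, the diameter of the simplex otherwise. *)
have [Wr|rW] := leP W (r ^+ 2 / 2).
- apply: (@le_trans _ _ (M%:E * (Z * W)%:E)%E).
    apply: (le_trans (integral_simplex_le _ md2L d2L0)).
    by rewrite lee_wpmul2l ?lee_fin//; exact: flatZ.
  have BZ : ((Z / 2)%:E <= \int[lebesgue_rV n]_(t in box) (L t)%:E)%E.
    have bS : box `<=` simplex n by move=> t [].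
    have := integral_dirichlet_monomial (R := R) nu m.
    rewrite -/Z -(setDUK bS) ge0_integral_setU//; last 4 first.
    - exact: measurableD.
    - by apply: measurable_funTS.
    - by move=> t; rewrite setDUK// => St; rewrite lee_fin L0.
    - by rewrite disj_set2E setDIK.
    (* Outside the box [1 <= d2 t / r ^+ 2], so the mass there is at most [Z * W / r ^+ 2]; the
       threshold [r ^+ 2 / 2] on [W] is chosen to make this [Z / 2]. *)
    have out : (\int[lebesgue_rV n]_(t in simplex n `\` box) (L t)%:E <= (Z / 2)%:E)%E.
      apply: (@le_trans _ _ ((r ^- 2)%:E *
          \int[lebesgue_rV n]_(t in simplex n) (d2 t * L t)%:E)%E); last first.
        apply: (@le_trans _ _ ((r ^- 2)%:E * (Z * W)%:E)%E).
          by rewrite lee_wpmul2l ?lee_fin ?invr_ge0 ?(ltW r20)//; exact: flatZ.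
        by rewrite -EFinM lee_fin ler_pdivrMl//; nra.
      apply: (@le_trans _ _ ((r ^- 2)%:E *
          \int[lebesgue_rV n]_(t in simplex n `\` box) (d2 t * L t)%:E)%E); last first.
        rewrite lee_wpmul2l ?lee_fin ?invr_ge0 ?(ltW r20)//.
        by apply: ge0_subset_integral => //; [exact: measurableD|exact: measurable_funTS].
      rewrite -ge0_integralZl_EFin ?invr_ge0 ?(ltW r20)//; last 3 first.
      - exact: measurableD.
      - by move=> t [St _]; rewrite lee_fin d2L0.
      - exact: measurable_funTS.
      apply: ge0_le_integral => //.
      - exact: measurableD.
      - by move=> t [St _]; rewrite lee_fin L0.
      - exact: measurable_funTS.
      - by apply: measurable_funeM; exact: measurable_funTS.
      move=> t [St /not_andP[//|/existsNP[k /negP]]]; rewrite -leNgt => rt.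
      rewrite -EFinM lee_fin mulrA ler_peMl ?L0// mulrC ler_pdivlMr// mul1r.
      apply: (@le_trans _ _ ((t ord0 k - t0 ord0 k) ^+ 2)).
        by rewrite -(real_normK (num_real (_ - _))) lerXn2r ?nnegrE// ltW.
      rewrite /d2 (bigD1 k)//= lerDl; apply: sumr_ge0 => i _; exact: sqr_ge0.
    move=> E; rewrite -(leeD2rE (x := (Z / 2)%:E))//.
    rewrite -EFinD -splitr -E; exact: leeD.
  (* The bound [M * Z * W] is factored so as to exhibit [c * (Z / 2)], which lies below the
     evidence. *)
  apply: (@le_trans _ _ ((2 * M / c * W)%:E * (c%:E * (Z / 2)%:E))%E).
    rewrite -!EFinM lee_fin le_eqVlt; apply/orP; left; apply/eqP.
    by field; rewrite lt0r_neq0.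
  apply: (@le_trans _ _ ((2 * M / c * W)%:E * \int[p]_(t in simplex n) (L t)%:E)%E).
    apply: lee_wpmul2l; first by rewrite lee_fin mulr_ge0// divr_ge0 ?mulr_ge0// ltW.
    apply: le_trans (integral_p_ge _ mL' _); first by rewrite lee_wpmul2l// lee_fin ltW.
    by move=> t St; rewrite lee_fin L0.
  apply: lee_wpmul2r => //; rewrite lee_fin ler_wpM2r// lerDl.
  by rewrite divr_ge0 ?mulr_ge0// ltW.
- apply: (@le_trans _ _ (n%:R%:E * \int[p]_(t in simplex n) (L t)%:E)%E).
    rewrite -ge0_integralZl_EFin//.
      apply: ge0_le_integral => //.
      + exact: measurable_funTS.
      + by apply: measurable_funeM; exact: measurable_funTS.
      + move=> t St; rewrite -EFinM lee_fin ler_wpM2r ?L0//.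
        exact: simplex_dist_le.
    exact: measurable_funTS.
  apply: lee_wpmul2r => //; rewrite lee_fin mulrDl.
  apply: (@le_trans _ _ (2 * n%:R / r ^+ 2 * W)); last first.
    by rewrite lerDr mulr_ge0// divr_ge0 ?mulr_ge0// ltW.
  rewrite mulrAC ler_pdivlMr// -mulrA mulrCA ler_wpM2l//; nra.
Qed.
End bound.
End posterior_moment.

(** * Coupling with a Dirac mass *)

Section with_density.
Import HBNNSimple.
Local Open Scope ereal_scope.
Context {d : measure_display} {T : measurableType d} {R : realType}.
Variables (p : {measure set T -> \bar R}) (g : T -> R).
Hypotheses (mg : measurable_fun setT g) (g0 : forall x, (0 <= g x)%R).

(** The two proofs are arguments so that the measure structure can be attached to the term
    itself. *)
Definition with_density of measurable_fun setT g & (forall x, (0 <= g x)%R) :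
  set T -> \bar R := fun A => \int[p]_(x in A) (g x)%:E.

Let mgE : measurable_fun setT (EFin \o g).
Proof. exact/measurable_EFinP. Qed.

Let nu := with_density mg g0.

Let with_density0 : nu set0 = 0.
Proof. exact: integral_set0. Qed.

Let with_density_ge0 A : 0 <= nu A.
Proof. by apply: integral_ge0 => x _; rewrite lee_fin. Qed.

Let with_density_sigma_additive : semi_sigma_additive nu.
Proof. by apply: semi_sigma_additive_nng_induced => // x; rewrite lee_fin. Qed.

HB.instance Definition _ := isMeasure.Build _ _ _ (with_density mg g0)
  with_density0 with_density_ge0 with_density_sigma_additive.

Let integral_with_density_nnsfun (h : {nnsfun T >-> R}) :
  \int[with_density mg g0]_x (h x)%:E = \int[p]_x ((h x)%:E * (g x)%:E).
Proof.
have mh r : measurable (h @^-1` [set r]) by [].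
transitivity (\int[p]_x \sum_(r \in range h) (r%:E * (\1_(h @^-1` [set r]) x)%:E * (g x)%:E)).
  rewrite ge0_integral_fsum//; last 2 first.
  - move=> r; apply: emeasurable_funM => //; apply: emeasurable_funM => //.
    exact/measurable_EFinP.
  - move=> r x _; apply: mule_ge0; last by rewrite lee_fin.
    by rewrite -EFinM nnfun_muleindic_ge0.
  rewrite integralT_nnsfun sintegralE; apply: eq_fsbigr => r.
  rewrite inE => -[x _ <-].
  under [RHS]eq_integral do rewrite -muleA.
  rewrite ge0_integralZl_EFin//; last 2 first.
  - by move=> y _; rewrite mule_ge0 ?lee_fin.
  - by apply: emeasurable_funM => //; exact/measurable_EFinP.
  congr (_ * _); rewrite /= /with_density [LHS]integral_mkcond.
  by apply: eq_integral => y _; rewrite muleC epatch_indic.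
apply: eq_integral => x _.
rewrite [in RHS](fimfunE h x) -fsumEFin// ge0_mule_fsuml//.
by move=> r; rewrite nnfun_muleindic_ge0.
Qed.

(** From simple functions to nonnegative ones by monotone convergence on both sides. *)
Lemma integral_with_density (f : T -> \bar R) : measurable_fun setT f ->
  (forall x, 0 <= f x) ->
  \int[with_density mg g0]_x f x = \int[p]_x (f x * (g x)%:E).
Proof.
move=> mf f0; pose h := nnsfun_approx measurableT mf.
have hf x : (h n x)%:E @[n --> \oo] --> f x by exact: cvg_nnsfun_approx.
have ndh x : nondecreasing_seq (fun n => (h n x)%:E).
  by move=> a b ab; rewrite lee_fin; exact/lefP/nd_nnsfun_approx.
have hg x : (h n x)%:E * (g x)%:E @[n --> \oo] --> f x * (g x)%:E.
  by apply: cvgeZr.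
transitivity (limn (fun n => \int[with_density mg g0]_x (h n x)%:E)).
  rewrite -monotone_convergence//.
  - by apply: eq_integral => x _; apply/esym/cvg_lim.
  - by move=> n; exact/measurable_EFinP.
  - by move=> n x _; rewrite lee_fin.
under eq_fun do rewrite integral_with_density_nnsfun.
rewrite -monotone_convergence//.
- by apply: eq_integral => x _; apply/cvg_lim.
- by move=> n; apply: emeasurable_funM => //; exact/measurable_EFinP.
- by move=> n x _; rewrite mule_ge0 ?lee_fin.
- by move=> x _ a b ab; apply: lee_wpmul2r; [rewrite lee_fin|exact: ndh].
Qed.

End with_density.

(** [mnormalize] falls back on [P] when the total mass is zero or infinite; the hypothesis excludes
    both. *)
Lemma mnormalize_pos_finite {d : measure_display} {T : measurableType d}
    {R : realType} (mu : {measure set T -> \bar R}) (P : probability T R)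
    (A : set T) : (0 < mu setT < +oo)%E ->
  mnormalize mu P A = ((mu setT)^-1 * mu A)%E.
Proof.
move=> /andP[mu0 muoo].
have fin : mu setT \is a fin_num by rewrite ge0_fin_numE.
rewrite /mnormalize (gt_eqF mu0) (lt_eqF muoo) /= muleC; congr (_ * _)%E.
by rewrite -{2}(fineK fin) inver gt_eqF// fine_gt0// mu0 muoo.
Qed.

(** The distance is an infimum, so one coupling suffices. It is realised as the image of the
    normalised measure under [t -> (t, t0)], which turns the transport cost into a second moment
    around [t0]. *)
Lemma wasserstein2_dirac_le {R : realType} {n : nat}
    (p : {measure set 'rV[R]_n -> \bar R}) (D : set 'rV[R]_n)
    (L : 'rV[R]_n -> R) (t0 : 'rV[R]_n) (b : R) :
  measurable D -> measurable_fun setT L -> (forall t, D t -> 0 <= L t) ->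
  (0 < \int[p]_(t in D) (L t)%:E < +oo)%E -> 0 <= b ->
  (\int[p]_(t in D) ((\sum_k (t ord0 k - t0 ord0 k) ^+ 2) * L t)%:E <=
    b%:E * \int[p]_(t in D) (L t)%:E)%E ->
  (wasserstein2 (fun A => \int[p]_(t in A `&` D) (L t)%:E / \int[p]_(t in D) (L t)%:E)%E
    (dirac t0) <= (Num.sqrt b)%:E)%E.
Proof.
move=> mD mL L0 /andP[I0 Ioo] b0 mom.
set I := (\int[p]_(t in D) (L t)%:E)%E in I0 Ioo mom *.
have Ifin : I \is a fin_num by rewrite ge0_fin_numE// ltW.
(* Extension by zero gives a weight that is nonnegative everywhere, as [with_density] requires. *)
pose g := L \_ D.
have g0 t : 0 <= g t by rewrite /g /patch; case: ifPn => // /set_mem /L0.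
have mg : measurable_fun setT g.
  by apply: (measurable_restrictT _ mD).1; exact: measurable_funTS.
have gE A : (\int[p]_(t in A) (g t)%:E = \int[p]_(t in A `&` D) (L t)%:E)%E.
  rewrite integral_mkcondr; apply: eq_integral => t _.
  by rewrite /g /patch; case: ifP.
pose pair0 (t : 'rV[R]_n) := (t, t0).
have mpair0 : measurable_fun setT pair0 by exact: measurable_fun_pair.
pose F : {mfun _ >-> _} := HB.pack pair0 (isMeasurableFun.Build _ _ _ _ _ mpair0).
pose nu := with_density p g mg g0.
have nuE A : nu A = (\int[p]_(t in A `&` D) (L t)%:E)%E by exact: gE.
have nuT : nu setT = I by rewrite nuE setTI.
pose Q : probability 'rV[R]_n R := mnormalize (with_density p g mg g0) (dirac t0).
have QE A : (Q A = I^-1 * nu A)%E.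
  rewrite -nuT; apply: mnormalize_pos_finite.
  by rewrite [X in (0 < X < _)%E]nuT I0.
pose gam : probability ('rV[R]_n * 'rV[R]_n)%type R := distribution Q F.
have cgam : coupling (fun A => \int[p]_(t in A `&` D) (L t)%:E / I)%E (dirac t0) gam.
  move=> A mA; split; rewrite /gam /= /distribution /pushforward.
    rewrite [LHS]QE muleC -nuE; congr (nu _ * _)%E.
    by apply/seteqP; split => // t [].
  rewrite diracE; case: (boolP (t0 \in A)) => [/set_mem At0|/negP At0].
    rewrite (_ : F @^-1` ([set: 'rV[R]_n] `*` A) = [set: 'rV[R]_n]).
      exact: probability_setT.
    by apply/seteqP; split.
  rewrite (_ : F @^-1` ([set: 'rV[R]_n] `*` A) = set0 :> set 'rV[R]_n).
    exact: measure0.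
  by apply/seteqP; split => // t [_ /mem_set].
apply: (@le_trans _ _ ((\int[gam]_z (euclid_dist z.1 z.2 ^+ 2)%:E) `^ (2^-1))%E).
  by apply: ereal_inf_lbound; exists gam.
have edist2 (s t : 'rV[R]_n) : euclid_dist s t ^+ 2 = \sum_k (s ord0 k - t ord0 k) ^+ 2.
  by rewrite sqr_sqrtr// sumr_ge0// => k _; exact: sqr_ge0.
have md2 : measurable_fun setT (fun t : 'rV[R]_n => \sum_k (t ord0 k - t0 ord0 k) ^+ 2).
  apply: measurable_sum => k; apply: measurable_funX; apply: measurable_funB => //.
  exact: measurable_rV_coord.
have md : measurable_fun setT (fun z : 'rV[R]_n * 'rV[R]_n => (euclid_dist z.1 z.2 ^+ 2)%:E).
  under eq_fun do rewrite edist2.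
  apply/measurable_EFinP; apply: measurable_sum => k; apply: measurable_funX.
  apply: measurable_funB.
    exact: (measurableT_comp (measurable_rV_coord k) measurable_fst).
  exact: (measurableT_comp (measurable_rV_coord k) measurable_snd).
pose J := (fine I)^-1.
have J0 : 0 <= J by rewrite invr_ge0 fine_ge0// ltW.
have cost : (\int[gam]_z (euclid_dist z.1 z.2 ^+ 2)%:E <= b%:E)%E.
  rewrite ge0_integral_distribution//; last by move=> z; rewrite lee_fin sqr_ge0.
  (* Written as a real multiple of the weighted measure, [Q] lets the factor [J] leave the
     integral. *)
  rewrite (eq_measure_integral (mscale (NngNum J0) (with_density p g mg g0))); last first.
    move=> A _ _; rewrite [LHS]QE; congr (_ * _)%E.
    by rewrite -{1}(fineK Ifin) inver gt_eqF// fine_gt0// I0 Ioo.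
  have mdF : measurable_fun setT (fun t => (euclid_dist t t0 ^+ 2)%:E).
    by under eq_fun do rewrite edist2; exact/measurable_EFinP.
  rewrite ge0_integral_mscale//; last by move=> t _; rewrite lee_fin sqr_ge0.
  rewrite /= integral_with_density//; last by move=> t; rewrite lee_fin sqr_ge0.
  rewrite lee_pdivrMl; last by rewrite fine_gt0// I0 Ioo.
  rewrite fineK// muleC; apply: le_trans mom.
  rewrite [leRHS]integral_mkcond le_eqVlt; apply/orP; left; apply/eqP.
  apply: eq_integral => t _; rewrite /g /patch edist2.
  by case: ifP => _; rewrite -EFinM ?mulr0.
rewrite -powR12_sqrt// -poweR_EFin; apply: gt0_ler_poweR => //.
- by rewrite in_itv/= leey andbT; apply: integral_ge0 => z _; rewrite lee_fin sqr_ge0.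
- by rewrite in_itv/= lee_fin b0 leey.
Qed.

(** * Bounds on the prior *)

(* Unlike ge0_le_integral this asks for no measurability, which would have to be
   proved for the density and for the Wasserstein distance. *)
Lemma le_integral_ge0 {d : measure_display} {T : measurableType d} {R : realType}
    (mu : {measure set T -> \bar R}) (D : set T) (f g : T -> \bar R) :
  (forall x, D x -> (0 <= f x)%E) -> (forall x, D x -> (f x <= g x)%E) ->
  (\int[mu]_(x in D) f x <= \int[mu]_(x in D) g x)%E.
Proof.
move=> f0 fg; rewrite !ge0_integralE//; last first.
  by move=> x Dx; exact: le_trans (f0 x Dx) (fg x Dx).
apply: ge_ereal_sup => _ [h /= hf <-]; apply: ereal_sup_ubound.
exists h => // x; apply: le_trans (hf x) _; rewrite /patch.
by case: ifPn => // /set_mem; exact: fg.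
Qed.

(** A closed subset of the compact unit cube. *)
Lemma compact_closure_simplex {R : realType} (n : nat) :
  compact (closure (simplex n : set 'rV[R]_n)).
Proof.
pose K : set 'rV[R]_n := [set v | forall i, `[0, 1]%classic (v ord0 i)].
have cK : compact K.
  apply: (@rV_compact R n (fun=> `[0, 1]%classic)) => _; exact: segment_compact.
have KE : K = closure K by apply/closure_id; apply: compact_closed => //; exact: (@norm_hausdorff R 'rV[R]_n).
apply: (subclosed_compact _ cK); first exact: closed_closure.
by rewrite KE; apply: closureS => t [t01 _] i; rewrite /= in_itv/= t01.
Qed.

Lemma density_upper_bound {R : realType} (n : nat) (q : 'rV[R]_n -> R) :
  {within closure (simplex n), continuous q} ->
  exists M, 0 <= M /\ forall t, simplex n t -> q t <= M.
Proof.
move=> cq; have := continuous_compact cq (compact_closure_simplex n).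
move=> /(@compact_bounded _ R^o)[M [Mreal qM]].
(* Boundedness supplies a bound at every real strictly above [M]; this one is also nonnegative. *)
exists (`|M| + 1); split; first by rewrite addr_ge0.
move=> t St; apply: le_trans (ler_norm _) _.
apply: (qM (`|M| + 1)); first by rewrite (le_lt_trans (ler_norm _))// ltrDl.
by exists t => //; exact: subset_closure.
Qed.

Lemma density_lower_bound {R : realType} (n : nat) (q : 'rV[R]_n -> R)
    (t0 : 'rV[R]_n) : {within closure (simplex n), continuous q} ->
  interior (simplex n) t0 -> 0 < q t0 ->
  exists r : R, [/\ 0 < r, forall t : 'rV[R]_n, (forall k, `|t ord0 k - t0 ord0 k| < r) -> simplex n t &
    forall t, simplex_box t0 r t -> q t0 / 2 <= q t].
Proof.
move=> cq It0 q0.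
have It0' : interior (closure (simplex n)) t0.
  by apply: filterS It0; exact: subset_closure.
(* At an interior point of the closure, subspace neighbourhoods are ordinary ones, so relative
   continuity becomes continuity. *)
have qt0 : q x @[x --> t0] --> q t0.
  by rewrite (nbhs_subspace_interior It0'); exact: cq.
have : nbhs t0 (simplex n `&` [set t | q t0 / 2 < q t]).
  apply: filterI => //; apply: (cvgr_gt (q t0) qt0); lra.
move=> /nbhs_ballP[r /= r0 rS]; exists r; split => //.
- move=> t tr; apply: (rS t _).1; split => // i j.
  by rewrite (ord1 i) -ball_normE /= distrC.
- move=> t [_ tr]; apply/ltW/(rS t _).2; split => // i j.
  by rewrite (ord1 i) -ball_normE /= distrC.
Qed.

Lemma prior_le {R : realType} (n : nat) (p : probability 'rV[R]_n R)
    (q : 'rV[R]_n -> R) (M : R) : has_density (simplex n) p q ->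
  (forall t, simplex n t -> q t <= M) -> 0 <= M ->
  forall A, measurable A -> (p A <= M%:E * lebesgue_rV n A)%E.
Proof.
move=> [q0 pE] qM M0 A mA; rewrite pE//.
have mAS : measurable (A `&` simplex n) by apply: measurableI => //; exact: measurable_simplex.
apply: (@le_trans _ _ (\int[lebesgue_rV n]_(t in A `&` simplex n) M%:E)%E).
  by apply: le_integral_ge0 => t [_ St]; rewrite lee_fin ?q0 ?qM.
rewrite integral_cst// lee_wpmul2l//.
by apply: le_measure; rewrite ?inE//; exact: subIsetl.
Qed.

Lemma prior_ge {R : realType} (n : nat) (p : probability 'rV[R]_n R)
    (q : 'rV[R]_n -> R) (c : R) (B : set 'rV[R]_n) :
  has_density (simplex n) p q -> B `<=` simplex n ->
  (forall t, B t -> c <= q t) -> 0 <= c ->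
  forall A, measurable A -> A `<=` B -> (c%:E * lebesgue_rV n A <= p A)%E.
Proof.
move=> [q0 pE] BS qc c0 A mA AB; rewrite pE//.
rewrite (setIidl (subset_trans AB BS)) -integral_cst//.
by apply: le_integral_ge0 => t At; rewrite lee_fin// qc//; exact: AB.
Qed.

Lemma ler_prodn {R : realType} {n : nat} (nu : 'I_n -> nat) (e : R) (t : 'rV[R]_n) :
  0 <= e -> (forall k, e <= t ord0 k) ->
  \prod_i e ^+ nu i <= \prod_i t ord0 i ^+ nu i.
Proof.
move=> e0 et; apply: ler_prod => i _; rewrite exprn_ge0//= lerXn2r ?nnegrE//.
exact: le_trans (et i).
Qed.

(** Full support gives positive mass to a small open box on which the likelihood is at least [del].
    This holds for all exponents, so the posterior is a genuine probability for every sample. The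
    radius [r] is split in two: half for the box, half for displacements of its points. *)
Lemma evidence_gt0 {R : realType} (n : nat) (p : probability 'rV[R]_n.+1 R)
    (t0 : 'rV[R]_n.+1) (r : R) (nu : 'I_n.+1 -> nat) (m : nat) :
  full_support (simplex n.+1) p -> 0 < r ->
  (forall t : 'rV[R]_n.+1, (forall k, `|t ord0 k - t0 ord0 k| < r) -> simplex n.+1 t) ->
  (0 < \int[p]_(t in simplex n.+1) (dirichlet_monomial nu m 1 t)%:E)%E.
Proof.
move=> [_ psupp] r0 rS; pose e := r / 2.
have e0 : 0 < e by rewrite divr_gt0.
have er : e + e = r by rewrite /e -splitr.
pose U := simplex_box t0 e.
have mS := @measurable_simplex R n.+1.
have mU : measurable U by exact: measurable_simplex_box.
have US : U `<=` simplex n.+1 by move=> t [].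
have t0S : simplex n.+1 t0 by apply: rS => k; rewrite subrr normr0.
(* The constraint to the simplex is automatic at radius [e], so [U] is open and full support
   applies. *)
have UE : U = ball t0 e.
  apply/seteqP; split => t.
    by move=> [_ te]; split => // i j; rewrite (ord1 i) -ball_normE /= distrC.
  move=> [_ te]; have te' k : `|t ord0 k - t0 ord0 k| < e.
    by have := te ord0 k; rewrite -ball_normE /= distrC.
  split => //; apply: rS => k; apply: lt_trans (te' k) _.
  by rewrite -er ltrDl.
have pU : (0 < p U)%E.
  apply: psupp; first by rewrite UE; exact: ball_open.
  by exists t0; split => //; split => // k; rewrite subrr normr0.
(* Moving t by e along one axis stays in the simplex, hence every coordinate
   and the slack 1 - sum_k t_k are at least e on U. *)
have shift (s : R) (t : 'rV[R]_n.+1) (j : 'I_n.+1) : U t -> `|s| <= e ->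
    simplex n.+1 (\row_k (t ord0 k + s * (k == j)%:R)).
  move=> [_ te] se; apply: rS => k; rewrite mxE addrAC.
  apply: le_lt_trans (ler_normD _ _) _; rewrite -er; apply: ltr_leD; first exact: te.
  by case: eqP => _; rewrite ?mulr1 ?mulr0 ?normr0// ltW.
have Ue t k : U t -> e <= t ord0 k.
  move=> Ut; have := shift (- e) t k Ut; rewrite normrN gtr0_norm// lexx.
  by move=> /(_ isT)[/(_ k)]; rewrite mxE eqxx mulr1 subr_ge0 => /andP[].
have Us t : U t -> e <= 1 - \sum_k t ord0 k.
  move=> Ut; have := shift e t ord0 Ut; rewrite gtr0_norm// lexx => /(_ isT)[_].
  under eq_bigr do rewrite mxE; rewrite big_split/= -mulr_sumr.
  rewrite [X in _ * X](_ : _ = 1) ?mulr1 -?lerBrDl//.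
  by rewrite (bigD1 ord0)//= big1 ?addr0// => i /negbTE ->.
pose del := (\prod_i e ^+ nu i) * e ^+ m.
have del0 : 0 < del by rewrite mulr_gt0 ?exprn_gt0// prodr_gt0// => i _; rewrite exprn_gt0.
apply: (@lt_le_trans _ _ (del%:E * p U)%E); first by rewrite mule_gt0.
rewrite -integral_cst//.
apply: (@le_trans _ _ (\int[p]_(t in U) (dirichlet_monomial nu m 1 t)%:E)%E).
  apply: le_integral_ge0 => t Ut; rewrite lee_fin; first exact: ltW.
  apply: ler_pM; rewrite ?exprn_ge0 ?(ltW e0)//.
  - by apply: prodr_ge0 => i _; rewrite exprn_ge0// ltW.
  - exact: (ler_prodn nu e t (ltW e0) (fun k => Ue t k Ut)).
  - by rewrite lerXn2r ?nnegrE ?(ltW e0) ?Us// (le_trans (ltW e0))// Us.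
apply: ge0_subset_integral => //.
- by apply/measurable_EFinP/measurable_funTS; exact: measurable_dirichlet_monomial.
- by move=> t; rewrite simplexE lee_fin; exact: dirichlet_monomial_ge0.
Qed.

(** * Fluctuations of the counts *)

(** In the expanded square of the sum, the [n] diagonal terms have mean [c] and the [n ^ 2 - n]
    others, by pairwise independence, mean [c ^+ 2]. *)
Lemma indic_sum_variance {d : measure_display} {Omega : measurableType d}
    {R : realType} (P : probability Omega R) (B : nat -> set Omega) (c : R) (n : nat) :
  (forall j, measurable (B j)) -> (forall j, P (B j) = c%:E) ->
  (forall j k, j != k -> P (B j `&` B k) = (c ^+ 2)%:E) ->
  (\int[P]_w ((\sum_(j < n) \1_(B j) w - n%:R * c) ^+ 2)%:E =
   (n%:R * (c * (1 - c)))%:E)%E.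
Proof.
move=> mB PB PBB.
have c0 : 0 <= c by rewrite -lee_fin -(PB 0%N).
have mI A : measurable A -> measurable_fun setT (EFin \o (\1_A : Omega -> R)).
  by move=> mA; apply/measurable_EFinP.
have mS : measurable_fun setT (fun w => \sum_(j < n) \1_(B j) w : R).
  by apply: measurable_sum => j; exact: measurable_indic.
have S0 w : 0 <= \sum_(j < n) \1_(B j) w :> R by apply: sumr_ge0.
have EI j : (\int[P]_w (\1_(B j) w)%:E = c%:E)%E.
  by rewrite integral_indic// setIT; exact: PB.
have EII j k : j != k -> (\int[P]_w (\1_(B j `&` B k) w)%:E = (c ^+ 2)%:E)%E.
  by move=> jk; rewrite integral_indic ?setIT; [exact: PBB| |exact: measurableI].
have ES : (\int[P]_w (\sum_(j < n) \1_(B j) w)%:E = (n%:R * c)%:E)%E.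
  under eq_integral do rewrite -sumEFin.
  rewrite ge0_integral_sum//; last by move=> j; exact: mI.
  under eq_bigr do rewrite EI.
  by rewrite sumEFin sumr_const card_ord mulr_natl.
have ES2 : (\int[P]_w ((\sum_(j < n) \1_(B j) w) ^+ 2)%:E =
    (n%:R * c + (n%:R ^+ 2 - n%:R) * c ^+ 2)%:E)%E.
  under eq_integral => w _.
    rewrite expr2 big_distrlr/= -sumEFin.
    under eq_bigr => j _.
      rewrite -sumEFin.
      under eq_bigr => k _ do rewrite -[_ * _]/((\1_(B j) \* \1_(B k)) w) -indicI.
      over.
    over.
  rewrite /= ge0_integral_sum//; last 2 first.
  - move=> j; apply: emeasurable_sum => k; exact/mI/measurableI.
  - by move=> j w _; apply: sume_ge0 => k _; rewrite lee_fin.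
  under eq_bigr => j _.
    rewrite ge0_integral_sum//; last by move=> k; exact/mI/measurableI.
    rewrite (bigD1 j)//= setIid EI.
    rewrite (eq_bigr (fun=> (c ^+ 2)%:E)); last first.
      by move=> k kj; rewrite EII// eq_sym.
    rewrite sumEFin sumr_const cardC1 card_ord -EFinD.
    over.
  rewrite sumEFin sumr_const card_ord; congr EFin.
  (* Each row has [n.-1] off-diagonal terms; the truncated predecessor forces the case [n = 0]
     apart. *)
  case: (n) => [|k]; first by rewrite mulr0n; ring.
  by rewrite /= -mulr_natl -(mulr_natl (c ^+ 2)) -natr1; ring.
have := ES2.
set I2 := (X in (X = _)%E) => _.
(* The cross term is moved to the left so that only nonnegative functions are integrated; it is
   subtracted once its value is known to be finite. *)
have IE : (\int[P]_w ((\sum_(j < n) \1_(B j) w - n%:R * c) ^+ 2)%:E +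
    (2 * (n%:R * c))%:E * \int[P]_w (\sum_(j < n) \1_(B j) w)%:E =
    I2 + \int[P]_w ((n%:R * c) ^+ 2)%:E)%E.
  rewrite -ge0_integralZl_EFin//; last 2 first.
  - exact/measurable_EFinP.
  - by rewrite !mulr_ge0.
  rewrite /I2 -!ge0_integralD//.
  - by apply: eq_integral => w _; rewrite -EFinM -!EFinD; congr EFin; ring.
  - by move=> w _; rewrite lee_fin sqr_ge0.
  - by apply/measurable_EFinP; exact: measurable_funX.
  - by move=> w _; rewrite lee_fin sqr_ge0.
  - by move=> w _; rewrite lee_fin sqr_ge0.
  - by apply/measurable_EFinP; apply: measurable_funX; exact: measurable_funB.
  - by move=> w _; rewrite -EFinM lee_fin !mulr_ge0.
  - by apply: measurable_funeM; exact/measurable_EFinP.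
  by move=> w _; rewrite lee_fin.
move: IE; rewrite /I2 ES2 ES integral_cst// [X in (_ = _ + _ * X)%E -> _]probability_setT mule1 -EFinM -EFinD => IE.
rewrite -[LHS](addeK (x := (2 * (n%:R * c) * (n%:R * c))%:E))// IE -EFinB.
by congr EFin; ring.
Qed.

Lemma counts_indic {Omega : Type} {R : realType} (X : finType) (N : nat)
    (a : 'I_N -> X) (xi : nat -> Omega -> X) (n : nat) (i : 'I_N) (w : Omega) :
  (counts a n (xi ^~ w) i)%:R = \sum_(j < n) \1_(xi j @^-1` [set a i]) w :> R.
Proof.
rewrite /counts natr_sum; apply: eq_bigr => j _; rewrite indicE; congr (nat_of_bool _)%:R.
by apply/idP/idP => [/eqP xa|/set_mem ->//]; rewrite ?eqxx// inE.
Qed.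

Lemma counts_variance {d : measure_display} {Omega : measurableType d}
    {R : realType} (P : probability Omega R) (X : finType) (N : nat) (a : 'I_N -> X)
    (t0 : 'rV[R]_N.-1) (xi : nat -> Omega -> X) (n : nat) (i : 'I_N) :
  iid_multinomial P a t0 xi -> 0 <= full_param t0 i <= 1 ->
  (\int[P]_w (((counts a n (xi ^~ w) i)%:R - n%:R * full_param t0 i) ^+ 2)%:E <= n%:R%:E)%E.
Proof.
move=> [mxi ind Pxi] /andP[c0 c1].
under eq_integral do rewrite counts_indic.
rewrite (indic_sum_variance P (fun j => xi j @^-1` [set a i]) (full_param t0 i)).
- rewrite lee_fin ler_piMr// mulr_ile1// ?subr_ge0// lerBlDr lerDl//.
- by move=> j; exact: mxi.
- by move=> j; exact: Pxi.
(* Mutual independence on a two-element list is pairwise independence. *)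
- move=> j k jk; have := ind [:: j; k] (fun=> [set a i]).
  rewrite /= inE jk => /(_ isT); rewrite !big_cons big_nil mule1 !Pxi expr2 EFinM => <-.
  congr (P _); apply/seteqP; split => w.
    by move=> [wj wk] l /=; rewrite !inE => /orP[]/eqP ->.
  by move=> H; split; apply: H; rewrite /= !inE eqxx ?orbT.
Qed.

(** * The contraction rate *)

Lemma wasserstein2_ge0 {R : realType} {n : nat} (mu nu : set 'rV[R]_n -> \bar R) :
  (0 <= wasserstein2 mu nu)%E.
Proof. by apply: le_ereal_inf_tmp => _ [g _ <-]; exact: poweR_ge0. Qed.

(** [K] is chosen before [N] and [x]: it depends only on the dimension, on the bounds for [q] and on
    the radius of the box. This uniformity permits taking expectations afterwards. *)
Lemma wasserstein2_posterior_le {R : realType} (n : nat) (X : finType)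
    (a : 'I_n.+2 -> X) (p : probability 'rV[R]_n.+1 R) (t0 : 'rV[R]_n.+1)
    (q : 'rV[R]_n.+1 -> R) :
  bijective a -> full_support (simplex n.+1) p ->
  interior (simplex n.+1) t0 -> has_density (simplex n.+1) p q ->
  {within closure (simplex n.+1), continuous q} -> 0 < q t0 ->
  exists K, 0 <= K /\ forall (N : nat) (x : nat -> X), (0 < N)%N ->
    (wasserstein2 (posterior a p N x) (dirac t0) <=
     (Num.sqrt (K * (\sum_k
        (2 * ((counts a N x (widen_ord (leqnSn n.+1) k))%:R - N%:R * t0 ord0 k) ^+ 2
           / N%:R ^+ 2 + (2 * n.+3%:R ^+ 2 + 1) / N%:R))))%:E)%E.
Proof.
move=> ba psupp It0 pq cq q0.
have [M [M0 qM]] := density_upper_bound _ _ cq.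
have [r [r0 rS rq]] := density_lower_bound _ _ _ cq It0 q0.
have p_le := prior_le _ _ _ _ pq qM M0.
have c0 : 0 < q t0 / 2 by rewrite divr_gt0.
have boxS : simplex_box t0 r `<=` simplex n.+1 by move=> t [].
have p_ge := prior_ge _ _ _ _ _ pq boxS rq (ltW c0).
have St0 : simplex n.+1 t0 by exact: interior_subset It0.
have mS := @measurable_simplex R n.+1.
exists (2 * M / (q t0 / 2) + 2 * n.+1%:R / r ^+ 2); split.
  by rewrite addr_ge0// divr_ge0 ?mulr_ge0 ?sqr_ge0// ltW.
move=> N x N0; set W := \sum_k _.
have W0 : 0 <= W.
  apply: sumr_ge0 => k _; apply: addr_ge0; apply: divr_ge0; rewrite ?sqr_ge0//.
  by apply: mulr_ge0 => //; exact: sqr_ge0.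
rewrite /posterior likelihoodE.
pose nu (k : 'I_n.+1) := counts a N x (widen_ord (leqnSn n.+1) k); rewrite -/nu; set m := counts a N x ord_max.
have sumN : (\sum_i nu i + m = N)%N by rewrite -[RHS](sum_counts _ _ a N x ba) [RHS]big_ord_recr.
have mono t : simplex n.+1 t -> 0 <= dirichlet_monomial nu m (1 : R) t.
  by rewrite simplexE; exact: dirichlet_monomial_ge0.
apply: wasserstein2_dirac_le => //.
- exact: measurable_dirichlet_monomial.
- rewrite (evidence_gt0 _ _ _ _ _ _ psupp r0 rS) /=.
  (* The evidence is finite, being at most [M] times the flat one. *)
  apply: (@le_lt_trans _ _ (M%:E * (dirichlet_const nu m R)%:E)%E); last by rewrite -EFinM ltry.
  rewrite -integral_dirichlet_monomial; apply: integral_simplex_le => //.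
  by apply/measurable_EFinP; exact: measurable_dirichlet_monomial.
- by rewrite mulr_ge0// addr_ge0// divr_ge0 ?mulr_ge0 ?sqr_ge0// ltW.
- have := @posterior_second_moment_le R n.+1 p M _ r t0 M0 c0 r0 St0 p_le p_ge nu m.
  by rewrite sumN; apply.
Qed.

(** A linear majorant of the square root, so that the mean of [x] controls the mean of its root.
    Equality holds at [x = u ^- 2], hence the later choice of [u] as the root of the sample size,
    for [x] of order 1/N. *)
Lemma sqrt_le_amgm {R : realType} (x u : R) : 0 <= x -> 0 < u ->
  Num.sqrt x <= (u * x + u^-1) / 2.
Proof.
move=> x0 u0; rewrite -[in leRHS](sqr_sqrtr x0); set s := Num.sqrt x.
rewrite -subr_ge0.
have -> : (u * s ^+ 2 + u^-1) / 2 - s = (u * s - 1) ^+ 2 / u / 2.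
  by field; rewrite lt0r_neq0.
by rewrite !divr_ge0 ?sqr_ge0// ltW.
Qed.

Lemma PCR_le {R : realType} (n : nat) (X : finType)
    (a : 'I_n.+2 -> X) (p : probability 'rV[R]_n.+1 R) (t0 : 'rV[R]_n.+1)
    (d : measure_display) (Omega : measurableType d) (P : probability Omega R)
    (xi : nat -> Omega -> X) (K C : R) (N : nat) :
  iid_multinomial P a t0 xi -> simplex n.+1 t0 -> 0 <= K -> 0 <= C -> (0 < N)%N ->
  (forall x, (wasserstein2 (posterior a p N x) (dirac t0) <=
     (Num.sqrt (K * (\sum_k
        (2 * ((counts a N x (widen_ord (leqnSn n.+1) k))%:R - N%:R * t0 ord0 k) ^+ 2
           / N%:R ^+ 2 + C / N%:R))))%:E)%E) ->
  (PCR P a p t0 xi N <= (n.+1%:R * K * (2 + C) + 1)%:E * ((Num.sqrt N%:R)^-1)%:E)%E.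
Proof.
move=> hxi St0 K0 C0 N0 W2le; have [mxi _ _] := hxi.
have x0 : 0 < N%:R :> R by rewrite ltr0n.
pose u : R := Num.sqrt N%:R.
have u0 : 0 < u by rewrite sqrtr_gt0.
have u2 : u ^+ 2 = N%:R by rewrite sqr_sqrtr// ltW.
pose dev (k : 'I_n.+1) w : R :=
  ((counts a N (xi ^~ w) (widen_ord (leqnSn n.+1) k))%:R - N%:R * t0 ord0 k) ^+ 2.
have dev0 k w : 0 <= dev k w by exact: sqr_ge0.
have mdev k : measurable_fun setT (dev k).
  apply: measurable_funX; apply: measurable_funB => //.
  under eq_fun do rewrite counts_indic.
  by apply: measurable_sum => j; apply: measurable_indic; exact: mxi.
have Edev k : (\int[P]_w (dev k w)%:E <= N%:R%:E)%E.
  have := counts_variance P X n.+2 a t0 xi N (widen_ord (leqnSn n.+1) k) hxi.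
  by rewrite full_param_widen; apply; have [] := St0.
(* After linearisation, [A] is the coefficient of the squared count deviations, the factors 2 and
   1/2 cancelling, and [B] is the deterministic remainder. *)
pose A : R := u * K / N%:R ^+ 2.
pose B : R := (u * K * (n.+1%:R * (C / N%:R)) + u^-1) / 2.
have A0 : 0 <= A by rewrite divr_ge0 ?mulr_ge0 ?sqr_ge0// ltW.
have B0 : 0 <= B.
  by rewrite divr_ge0// addr_ge0 ?invr_ge0 ?(ltW u0)// !mulr_ge0 ?invr_ge0 ?(ltW u0).
rewrite /PCR.
apply: (@le_trans _ _ (\int[P]_w (A%:E * \sum_(k < n.+1) (dev k w)%:E + B%:E))%E).
  apply: le_integral_ge0 => w _; first exact: wasserstein2_ge0.
  apply: le_trans (W2le _) _; rewrite sumEFin -EFinM -EFinD lee_fin.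
  apply: le_trans (sqrt_le_amgm _ u _ u0) _.
    rewrite mulr_ge0// sumr_ge0// => k _; apply: addr_ge0; last by rewrite divr_ge0.
    by apply: divr_ge0; rewrite ?sqr_ge0//; apply: mulr_ge0 => //; exact: sqr_ge0.
  rewrite big_split/= sumr_const card_ord.
  under eq_bigr do rewrite mulrAC -/(dev _ w).
  rewrite -mulr_sumr -mulr_natl /A /B le_eqVlt; apply/orP; left; apply/eqP.
  by field; rewrite !lt0r_neq0.
have mdevE k : measurable_fun setT (fun w => (dev k w)%:E) by exact/measurable_EFinP.
rewrite ge0_integralD//; last 2 first.
- by move=> w _; rewrite mule_ge0// sume_ge0// => k _; rewrite lee_fin.
- by apply: measurable_funeM; exact: emeasurable_sum.
rewrite ge0_integralZl_EFin//; last 2 first.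
- by move=> w _; rewrite sume_ge0// => k _; rewrite lee_fin.
- exact: emeasurable_sum.
rewrite ge0_integral_sum//; last by move=> k w _; rewrite lee_fin.
rewrite integral_cst// [X in (_ + _ * X <= _)%E]probability_setT mule1.
apply: (@le_trans _ _ (A%:E * (\sum_(k < n.+1) N%:R%:E) + B%:E)%E).
  by apply: leeD => //; apply: lee_wpmul2l => //; exact: lee_sum.
rewrite sumEFin sumr_const card_ord -(mulr_natl N%:R n.+1) -!EFinM -EFinD lee_fin.
rewrite /A /B -/u -u2 -subr_ge0.
(* The quantity subtracted is exactly half of the claimed bound, so the difference is the other
   half. *)
have -> : (n.+1%:R * K * (2 + C) + 1) / u - (u * K / u ^+ 2 ^+ 2 * (n.+1%:R * u ^+ 2)
    + (u * K * (n.+1%:R * (C / u ^+ 2)) + u^-1) / 2) =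
    (n.+1%:R * K * (1 + C / 2) + 1 / 2) / u.
  by field; rewrite lt0r_neq0.
by rewrite divr_ge0 ?(ltW u0)// addr_ge0// !mulr_ge0// addr_ge0// divr_ge0.
Qed.

Theorem proposition4p3 (R : realType) (N : nat) (hN : (2 <= N)%N)
    (X : finType) (a : 'I_N -> X) (ha : bijective a)
    (p : probability 'rV[R]_N.-1 R) (hp : full_support (simplex N.-1) p)
    (t0 : 'rV[R]_N.-1) (ht0 : interior (simplex N.-1) t0)
    (q : 'rV[R]_N.-1 -> R) (hq : has_density (simplex N.-1) p q)
    (hqC1 : C1_closure (simplex N.-1) q)
    (hq0 : forall t, frontier (simplex N.-1) t -> q t = 0)
    (hqt0 : 0 < q t0)
    (d : measure_display) (Omega : measurableType d) (P : probability Omega R)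
    (xi : nat -> Omega -> X) (hxi : iid_multinomial P a t0 xi) :
  (\forall n \near \oo, PCR P a p t0 xi n \is a fin_num) /\
  (fun n : nat => fine (PCR P a p t0 xi n)) =O_\oo
    (fun n : nat => n%:R `^ (- 2^-1)).
Proof.
move: hN a ha p hp t0 ht0 q hq hqC1 hq0 hqt0 d Omega P xi hxi.
(* Writing [N] as [n.+2] lets [N.-1] compute to the positive dimension [n.+1]. *)
case: N => [|[|n]]// _ a ba p psupp t0 It0 q pq [cq _] _ q0 d Omega P xi hxi.
have [K [K0 W2le]] := wasserstein2_posterior_le _ _ _ _ _ _ ba psupp It0 pq cq q0.
pose C : R := 2 * n.+3%:R ^+ 2 + 1.
have C0 : 0 <= C by rewrite addr_ge0// mulr_ge0// sqr_ge0.
pose K' : R := n.+1%:R * K * (2 + C) + 1.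
have K'0 : 0 <= K' by rewrite addr_ge0// !mulr_ge0// addr_ge0.
have St0 : simplex n.+1 t0 by exact: interior_subset It0.
have PCRle N : (0 < N)%N -> (PCR P a p t0 xi N <= (K' / Num.sqrt N%:R)%:E)%E.
  move=> N0; rewrite EFinM; apply: PCR_le => // x.
  exact: W2le.
have PCR0 N : (0 <= PCR P a p t0 xi N)%E.
  by apply: integral_ge0 => w _; exact: wasserstein2_ge0.
have PCRfin N : (0 < N)%N -> PCR P a p t0 xi N \is a fin_num.
  by move=> N0; rewrite ge0_fin_numE//; apply: le_lt_trans (PCRle N N0) _; exact: ltry.
split; first by near=> N; apply: PCRfin; near: N; exact: nbhs_infty_gt.
(* Here [k] is the constant of the O, eventually above [K']; [N] is taken positive because the bound
   divides by it. *)
apply/eqOP; near=> k; near=> N.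
have N0 : (0 < N)%N by near: N; exact: nbhs_infty_gt.
rewrite ger0_norm ?fine_ge0// powRN powR12_sqrt// ger0_norm ?invr_ge0//.
apply: (@le_trans _ _ (K' / Num.sqrt N%:R)).
  by rewrite -lee_fin fineK ?PCRfin// PCRle.
rewrite ler_wpM2r ?invr_ge0//; near: k; exact: nbhs_pinfty_ge.
Unshelve. all: by end_near. Qed.
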